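(* Let $(X,D)$ be a Kähler snc pair, and $a\in\mathrm{Amp}_{\mathrm{nice}}(X,D)$. Then there exists a nice cone $\mathsf{N}\subset\mathrm{Nef}(X,D)$ containing $a$ in its interior. In fact, $\mathsf{N}$ can be chosen to be rational polyhedral and contained in $\mathrm{sAmp}(X,D)$.
   Context: A snc pair $(X,D)$ is a smooth compact complex manifold $X$ with a simple normal crossings divisor $D=\bigcup_{p\in P}D_p$ (irreducible components). $H^2(X,X\setminus D;\mathbb{R})\cong\mathbb{R}^P$ is identified with $\mathbb{R}$-divisors supported on $D$, $\sum_p\ell_pPD(D_p)\leftrightarrow\sum_p\ell_pD_p$. $\mathrm{Nef}(X,D)\subset\mathbb{R}^P$ is the closed cone of effective nef divisors supported on $D$; $\mathrm{Amp}(X,D)\subset\mathbb{R}^P$ is the open cone of ample divisors $\sum_p\ell_pD_p$ with $\ell_p>0$ for all $p$; $\mathrm{sAmp}(X,D)\subset\mathrm{Nef}(X,D)$ is the cone generated by semi-ample effective divisors supported on $D$ (those for which some positive tensor power of the corresponding line bundle is basepoint-free). $(X,D)$ is Kähler if $\mathrm{Amp}(X,D)\ne\emptyset$. For $K\subset P$ let $\bar K=P\setminus K$, $D_K=\bigcap_{p\in K}D_p$ (with $D_\emptyset=X$) and $D^K=\bigcup_{p\in\bar K}D_p$, so that $\mathrm{Amp}(X,D^K)\subset H^2(X,X\setminus D^K;\mathbb{R})\cong\mathbb{R}^{\bar K}$ maps to $H^2(X;\mathbb{R})$. Define $$\mathrm{Amp}'(X,D)=\bigcap_{K:D_K\neq\emptyset}\mathrm{im}\big(\mathrm{Amp}(X,D^K)\to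 H^2(X;\mathbb{R})\big),$$ and let $\mathrm{Amp}_{\mathrm{nice}}(X,D)$ be the interior of $\{a\in\mathrm{Amp}(X,D):\mathrm{im}(a)\in\mathrm{Amp}'(X,D)\}$, where $\mathrm{im}(a)$ is the image of $a$ in $H^2(X;\mathbb{R})$. A full-dimensional convex sub-cone $\mathsf{N}\subset\mathrm{Nef}(X,D)$ is nice if, with $\mathsf{N}^K=\mathsf{N}\cap\mathbb{R}^{\bar K}$, for all $K$ with $D_K\ne\emptyset$: $\mathsf{N}^K\subset\mathbb{R}^{\bar K}$ is full-dimensional, and the image of $\mathsf{N}$ under $H^2(X,X\setminus D;\mathbb{R})\to H^2(X;\mathbb{R})$ equals the image of $\mathsf{N}^K$. *)

(* Defs.v *)
From HB Require Import structures.
From mathcomp Require Import all_boot all_order all_algebra.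
From mathcomp Require Import complex.
From mathcomp Require Import all_classical all_reals all_analysis.
Set Implicit Arguments.
Unset Strict Implicit.
Unset Printing Implicit Defensive.
Import Order.TTheory GRing.Theory Num.Theory.
Import numFieldNormedType.Exports.
Local Open Scope classical_set_scope.
Local Open Scope complex_scope.
Local Open Scope ring_scope.

Local Notation ReC := (@complex.Re _).
Local Notation ImC := (@complex.Im _).

(* C^n as a real normed space: the pair (x, y) stands for x + i y, so that
   [derivable] and ['D_v] are derivatives in real directions. *)
Notation Cspace R n := ('rV[R]_n * 'rV[R]_n)%type.

Section ComplexSpace.
Variables (R : realType) (n : nat).
Implicit Types (U : set (Cspace R n)) (v z : Cspace R n).

Definition mul_i v : Cspace R n := (- v.2, v.1).

Definition coord (k : 'I_n) z : R[i] := z.1 0 k +i* z.2 0 k.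

Definition axis (k : 'I_n) (w : R[i]) : Cspace R n :=
  (ReC w *: delta_mx 0 k, ImC w *: delta_mx 0 k).

Fixpoint Ck (r : nat) U (f : Cspace R n -> R) : Prop :=
  match r with
  | 0%N => forall z, U z -> {for z, continuous f}
  | r'.+1 => forall v, (forall z, U z -> derivable f z v) /\
                       Ck r' U (fun z => 'D_v f z)
  end.

Definition smooth U (f : Cspace R n -> R) : Prop := forall r, Ck r U f.

Definition smoothC U (f : Cspace R n -> R[i]) : Prop :=
  smooth U (fun y => ReC (f y)) /\ smooth U (fun y => ImC (f y)).

(* Smooth functions satisfying the Cauchy-Riemann equations
   D_{iv} f = i D_v f for all directions v. *)
Definition holo U (f : Cspace R n -> R[i]) : Prop :=
  smoothC U f /\
  forall z, U z -> forall v,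
    'D_(mul_i v) (fun y => ReC (f y)) z = - 'D_v (fun y => ImC (f y)) z /\
    'D_(mul_i v) (fun y => ImC (f y)) z = 'D_v (fun y => ReC (f y)) z.

(* Four times the value on (v, conj v) of the complex Hessian
   (d^2 f / dz_j d\bar z_k). *)
Definition levi (f : Cspace R n -> R) z v : R :=
  'D_v (fun y => 'D_v f y) z + 'D_(mul_i v) (fun y => 'D_(mul_i v) f y) z.

End ComplexSpace.

(* The values of [to_c] outside [dom], and of [of_c] outside [cod], are
   irrelevant. *)
Record chart (R : realType) (n : nat) (X : topologicalType) := Chart {
  dom : set X;
  cod : set (Cspace R n);
  to_c : X -> Cspace R n;
  of_c : Cspace R n -> X
}.

Section Charts.
Variables (R : realType) (n : nat) (X : topologicalType).
Implicit Types c : chart R n X.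

Definition is_chart c : Prop :=
  [/\ open (dom c), open (cod c),
      (forall x, dom c x -> [/\ cod c (to_c c x), of_c c (to_c c x) = x &
                                {for x, continuous (to_c c)}]) &
      (forall z, cod c z -> [/\ dom c (of_c c z), to_c c (of_c c z) = z &
                                {for z, continuous (of_c c)}])].

Definition holo_transition c c' : Prop :=
  forall k, holo (cod c `&` of_c c @^-1` dom c')
                 (coord k \o to_c c' \o of_c c).

Definition compatible c c' : Prop :=
  holo_transition c c' /\ holo_transition c' c.

End Charts.

Record compact_cmanifold (R : realType) (n : nat) := CompactCManifold {
  carrier :> topologicalType;
  atlas : set (chart R n carrier);
  atlas_chart : forall c, atlas c -> is_chart c;
  atlas_cover : forall x : carrier, exists2 c, atlas c & dom c x;
  atlas_compatible : forall c c', atlas c -> atlas c' -> compatible c c';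
  carrier_hausdorff : hausdorff_space carrier;
  carrier_compact : compact [set: carrier]
}.

Section Manifolds.
Variables (R : realType) (n : nat) (X : compact_cmanifold R n).
Implicit Types U : set X.

Definition msmooth U (f : X -> R) : Prop :=
  forall c, atlas c -> smooth (cod c `&` of_c c @^-1` U) (f \o of_c c).

Definition mholo U (f : X -> R[i]) : Prop :=
  forall c, atlas c -> holo (cod c `&` of_c c @^-1` U) (f \o of_c c).

(* A hermitian metric on the tangent bundle, given in each chart of the atlas
   by its real part: a Riemannian metric invariant under multiplication by i. *)
Record hermitian_metric (h : chart R n X -> Cspace R n ->
                             Cspace R n -> Cspace R n -> R) : Prop := {
  hm_sym : forall c z u v, atlas c -> cod c z -> h c z u v = h c z v u;
  hm_lin : forall c z (a : R) u u' v, atlas c -> cod c z ->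
    h c z (a *: u + u') v = a * h c z u v + h c z u' v;
  hm_i : forall c z u v, atlas c -> cod c z ->
    h c z (mul_i u) (mul_i v) = h c z u v;
  hm_pos : forall c z v, atlas c -> cod c z -> v != 0 -> 0 < h c z v v;
  hm_smooth : forall c u v, atlas c -> smooth (cod c) (fun z => h c z u v);
  hm_change : forall c c' z u v, atlas c -> atlas c' ->
    cod c z -> dom c' (of_c c z) ->
    let T : Cspace R n -> Cspace R n := to_c c' \o of_c c in
    h c z u v = h c' (T z) ('D_u T z) ('D_v T z)
}.

End Manifolds.

(* Sheaves of modules over the sheaf of holomorphic functions.  [sec U] and
   [smul U] are meaningful for U open, [smul U f] for f holomorphic on U, and
   [res U V] for V a subset of U. *)
Record omodule (R : realType) (n : nat) (X : compact_cmanifold R n) := OModule {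
  sec : set X -> zmodType;
  res : forall U V : set X, sec U -> sec V;
  smul : forall U : set X, (X -> R[i]) -> sec U -> sec U;
  res_id : forall U s, open U -> @res U U s = s;
  res_comp : forall U V W s, open U -> open V -> open W ->
    W `<=` V -> V `<=` U -> @res V W (@res U V s) = @res U W s;
  res_add : forall U V s t, open U -> open V -> V `<=` U ->
    @res U V (s + t) = @res U V s + @res U V t;
  sec_separated : forall (F : set (set X)) (s t : sec (\bigcup_(V in F) V)),
    (forall V, F V -> open V) ->
    (forall V, F V -> @res _ V s = @res _ V t) -> s = t;
  sec_glue : forall (F : set (set X)) (s : forall V, sec V),
    (forall V, F V -> open V) ->
    (forall V W, F V -> F W ->
       @res V (V `&` W) (s V) = @res W (V `&` W) (s W)) ->
    exists t : sec (\bigcup_(V in F) V), forall V, F V -> @res _ V t = s V;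
  smul_ext : forall U f g s, open U -> mholo U f -> mholo U g ->
    (forall x, U x -> f x = g x) -> @smul U f s = @smul U g s;
  smul1 : forall U s, open U -> @smul U (fun=> 1) s = s;
  smulA : forall U f g s, open U -> mholo U f -> mholo U g ->
    @smul U f (@smul U g s) = @smul U (fun x => f x * g x) s;
  smulDl : forall U f g s, open U -> mholo U f -> mholo U g ->
    @smul U (fun x => f x + g x) s = @smul U f s + @smul U g s;
  smulDr : forall U f s t, open U -> mholo U f ->
    @smul U f (s + t) = @smul U f s + @smul U f t;
  res_smul : forall U V f s, open U -> open V -> V `<=` U -> mholo U f ->
    @res U V (@smul U f s) = @smul V f (@res U V s)
}.
Arguments res {R n X} F {U} V s : rename.
Arguments smul {R n X} F {U} f s : rename.

Section Coherent.
Variables (R : realType) (n : nat) (X : compact_cmanifold R n).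
Variable F : omodule X.

(* The germs at x of the sections e_k generate the stalk F_x. *)
Definition generates_at (x : X) (U : set X) (p : nat)
    (e : 'I_p -> sec F U) : Prop :=
  forall V (s : sec F V), open V -> V x -> V `<=` U ->
    exists W, [/\ open W, W x, W `<=` V &
      exists2 a : 'I_p -> X -> R[i], (forall k, mholo W (a k)) &
        res F W s = \sum_k smul F (a k) (res F W (e k))].

(* Existence, around every point, of a presentation O^q -> O^p -> F -> 0, given
   by the generators e_k and the relations r_l; by Oka's theorem these are the
   coherent sheaves. *)
Definition coherent : Prop :=
  forall x : X, exists (U : set X) (p q : nat) (e : 'I_p -> sec F U)
                       (r : 'I_q -> 'I_p -> X -> R[i]),
  [/\ open U, U x, (forall y, U y -> generates_at y e),
      (forall l, (forall k, mholo U (r l k)) /\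
                 \sum_k smul F (r l k) (e k) = 0) &
      forall (V : set X) (a : 'I_p -> X -> R[i]), open V -> V `<=` U ->
        (forall k, mholo V (a k)) ->
        \sum_k smul F (a k) (res F V (e k)) = 0 ->
        forall y, V y -> exists W, [/\ open W, W y, W `<=` V &
          exists2 b : 'I_q -> X -> R[i], (forall l, mholo W (b l)) &
            forall k z, W z -> a k z = \sum_l b l z * r l k z]].

End Coherent.

Definition local_eqn (R : realType) (n : nat) (X : topologicalType)
    (c : chart R n X) (o : option 'I_n) (x : X) : R[i] :=
  if o is Some k then coord k (to_c c x) else 1.

(* D is the union of the D_p, p : 'I_m.  It is described by a cover by
   holomorphic charts in which every D_p is empty or a coordinate hyperplane,
   distinct components giving distinct coordinates.  The components are smooth,
   hence irreducible exactly when they are connected.  [snc_tr p i j] is the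
   holomorphic extension of the quotient of the local equations of D_p in the
   charts i and j (it exists and is unique): these are the transition functions
   of the line bundle O(D_p).  They are a field only to have a name for them. *)
Record snc_divisor (R : realType) (n : nat) (X : compact_cmanifold R n)
    (m : nat) := SncDivisor {
  comp : 'I_m -> set X;
  comp_nonempty : forall p, comp p !=set0;
  comp_connected : forall p, connected (comp p);
  snc_idx : Type;
  snc_chart : snc_idx -> chart R n X;
  snc_is_chart : forall i, is_chart (snc_chart i);
  snc_compatible : forall i c, atlas c -> compatible (snc_chart i) c;
  snc_cover : forall x : X, exists i, dom (snc_chart i) x;
  label : snc_idx -> 'I_m -> option 'I_n;
  label_inj : forall i p q k, label i p = Some k -> label i q = Some k -> p = q;
  comp_eqn : forall i p x, dom (snc_chart i) x ->
    (comp p x <-> local_eqn (snc_chart i) (label i p) x = 0);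
  snc_tr : 'I_m -> snc_idx -> snc_idx -> X -> R[i];
  snc_tr_holo : forall p i j,
    mholo (dom (snc_chart i) `&` dom (snc_chart j)) (snc_tr p i j);
  snc_tr_eqn : forall p i j x, dom (snc_chart i) x -> dom (snc_chart j) x ->
    local_eqn (snc_chart i) (label i p) x =
    snc_tr p i j x * local_eqn (snc_chart j) (label j p) x;
  snc_tr_id : forall p i x, dom (snc_chart i) x -> snc_tr p i i x = 1;
  snc_tr_cocycle : forall p i j k x, dom (snc_chart i) x ->
    dom (snc_chart j) x -> dom (snc_chart k) x ->
    snc_tr p i j x * snc_tr p j k x = snc_tr p i k x
}.

Section SncPairs.
Variables (R : realType) (n : nat) (X : compact_cmanifold R n) (m : nat).
Variable D : snc_divisor X m.
Implicit Types (K : {set 'I_m}) (E : 'I_m -> int) (l : 'rV[R]_m).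
Implicit Types (N : set 'rV[R]_m) (i j : snc_idx D) (x : X).

Let W i : set X := dom (snc_chart i).

Definition strata K : set X := [set x | forall p, p \in K -> comp D p x].

(* The transition functions of O(E), E = \sum_p E_p D_p. *)
Definition bundle_tr E i j x : R[i] := \prod_p (snc_tr p i j x) ^ (E p).

(* A global holomorphic section of O(E)^{\otimes k}. *)
Definition is_section E (k : nat) (s : snc_idx D -> X -> R[i]) : Prop :=
  (forall i, mholo (W i) (s i)) /\
  (forall i j x, W i x -> W j x -> s i x = bundle_tr E i j x ^+ k * s j x).

Definition basepoint_free E (k : nat) : Prop :=
  forall x, exists2 s, is_section E k s & exists2 i, W i x & s i x != 0.

Definition semiample E : Prop := exists2 k, (0 < k)%N & basepoint_free E k.

(* A global section of F \otimes O(E)^{\otimes k}. *)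
Definition is_twisted_section (F : omodule X) E (k : nat)
    (t : forall i, sec F (W i)) : Prop :=
  forall i j, res F (W i `&` W j) (t i) =
    smul F (fun x => bundle_tr E i j x ^+ k) (res F (W i `&` W j) (t j)).

Definition globally_generated (F : omodule X) E (k : nat) : Prop :=
  forall x, exists i, W i x /\
    exists (r : nat) (t : 'I_r -> forall j, sec F (W j)),
      (forall a, is_twisted_section E k (t a)) /\
      generates_at x (fun a => t a i).

(* The line bundle O(E) is ample: for every coherent sheaf F, the sheaves
   F \otimes O(E)^{\otimes k} are globally generated for k >> 0. *)
Definition ample E : Prop :=
  forall F : omodule X, coherent F ->
    exists k0 : nat, forall k, (k0 <= k)%N -> globally_generated F E k.

(* An ample R-divisor is a (nonempty) positive combination of ample integral
   divisors. *)
Definition ampleR l : Prop :=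
  exists (r : nat) (c : 'I_r.+1 -> R) (A : 'I_r.+1 -> 'I_m -> int),
    [/\ forall a, 0 < c a, forall a, ample (A a) &
        forall p, l 0 p = \sum_a c a * (A a p)%:~R].

(* Smooth hermitian metrics on the R-line bundle O(l): the squared norm of a
   section with local representatives s_i is |s_i|^2 exp (- w_i). *)
Definition is_bundle_metric l (w : snc_idx D -> X -> R) : Prop :=
  (forall i, msmooth (W i) (w i)) /\
  (forall i j x, W i x -> W j x ->
     w i x = w j x + \sum_p l 0 p *
       ln (ReC (snc_tr p i j x) ^+ 2 + ImC (snc_tr p i j x) ^+ 2)).

(* Nefness on a compact complex manifold: for every hermitian metric h on X and
   every eps > 0, O(l) has a smooth metric whose curvature is >= - eps h. *)
Definition nef l : Prop :=
  forall h, hermitian_metric h -> forall eps : R, 0 < eps ->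
    exists2 w, is_bundle_metric l w &
      forall i (c : chart R n X) z v, atlas c -> cod c z -> W i (of_c c z) ->
        - eps * h c z v v <= levi (w i \o of_c c) z v.

Definition Nef : set 'rV[R]_m :=
  [set l : 'rV[R]_m | (forall p, 0 <= l 0 p) /\ nef l].

(* The subspace of R^P of divisors supported on D^K, i.e. R^{P \ K}. *)
Definition supported K : set 'rV[R]_m :=
  [set l : 'rV[R]_m | forall p, p \in K -> l 0 p = 0].

(* Amp (X, D^K), inside R^P. *)
Definition AmpK K : set 'rV[R]_m :=
  [set l : 'rV[R]_m |
    [/\ supported K l, forall p, p \notin K -> 0 < l 0 p & ampleR l]].

Definition Amp : set 'rV[R]_m := AmpK finset.set0.

Definition sAmp : set 'rV[R]_m :=
  [set l : 'rV[R]_m |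
    exists (r : nat) (c : 'I_r -> R) (A : 'I_r -> 'I_m -> int),
    [/\ forall a, 0 <= c a, forall a p, 0 <= A a p, forall a, semiample (A a) &
        forall p, l 0 p = \sum_a c a * (A a p)%:~R]].

Definition kahler : Prop := Amp !=set0.

Definition std_simplex (k : nat) : set 'rV[R]_k.+1 :=
  [set t | (forall a, 0 <= t 0 a) /\ \sum_a t 0 a = 1].

(* Only the restriction to the standard simplex matters, see [is_cochain]. *)
Definition singular (k : nat) (f : 'rV[R]_k.+1 -> X) : Prop :=
  {within @std_simplex k, continuous f}.

Definition face (k : nat) (a : 'I_k.+2) (t : 'rV[R]_k.+1) : 'rV[R]_k.+2 :=
  \row_b (if unlift a b is Some b' then t 0 b' else 0).

Definition cochain (k : nat) := ('rV[R]_k.+1 -> X) -> R.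

Definition is_cochain (k : nat) (u : cochain k) : Prop :=
  forall f g, singular f -> singular g ->
    (forall t, std_simplex t -> f t = g t) -> u f = u g.

Definition coboundary (k : nat) (u : cochain k) : cochain k.+1 :=
  fun f => \sum_(a < k.+2) (-1) ^+ a * u (f \o face a).

Definition is_cocycle (k : nat) (u : cochain k) : Prop :=
  is_cochain u /\
  forall f : 'rV[R]_k.+2 -> X, singular f -> coboundary u f = 0.

Definition cohomologous (k : nat) (u u' : cochain k.+1) : Prop :=
  exists2 b : cochain k, is_cochain b &
    forall f, singular f -> u f = u' f + coboundary b f.

(* Elements of H^2(X; R) are represented as sets of cocycles. *)
Definition H2class (u : cochain 2) : set (cochain 2) :=
  [set u' : cochain 2 | is_cocycle u' /\ cohomologous u' u].

(* Cocycles of the pair (X, X \ D). *)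
Definition is_rel_cocycle (k : nat) (u : cochain k) : Prop :=
  is_cocycle u /\
  forall f, singular f ->
    (forall t p, std_simplex t -> ~ comp D p (f t)) -> u f = 0.

(* The affine map from the standard 2-simplex onto the triangle with vertices
   1, i, -1-i, which is positively oriented and has 0 in its interior. *)
Definition triangle (t : 'rV[R]_3) : R[i] :=
  (t 0 ord0 - t 0 ord_max) +i* (t 0 (inord 1) - t 0 ord_max).

(* [f] is a small positively oriented disc (a singular 2-simplex) meeting D only
   at its center, which lies on D_p and no other component, and transverse to
   D_p there. *)
Definition meridian_disc (p : 'I_m) (f : 'rV[R]_3 -> X) : Prop :=
  exists (i : snc_idx D) (k : 'I_n) (z : Cspace R n) (eps : R),
    [/\ label i p = Some k, coord k z = 0,
        (forall q k', q != p -> label i q = Some k' -> coord k' z != 0),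
        0 < eps &
        forall t, std_simplex t ->
          cod (snc_chart i) (z + axis k (eps%:C * triangle t)) /\
          f t = of_c (snc_chart i) (z + axis k (eps%:C * triangle t))].

(* The identification H^2(X, X \ D; R) = R^P: the class of u corresponds to
   \sum_p l_p D_p when u takes the value l_p on the small discs transverse to
   D_p; in particular PD(D_p) is the Thom class of D_p. *)
Definition class_of_divisor (u : cochain 2) l : Prop :=
  is_rel_cocycle u /\
  forall p f, singular f -> meridian_disc p f -> u f = l 0 p.

(* The image of a subset of R^P = H^2(X, X \ D; R) in H^2(X; R). *)
Definition H2image N : set (set (cochain 2)) :=
  [set h : set (cochain 2) |
    exists u l, [/\ N l, class_of_divisor u l & h = H2class u]].

Definition Amp' : set (set (cochain 2)) :=
  [set h : set (cochain 2) | forall K, strata K !=set0 -> H2image (AmpK K) h].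

Definition Amp_nice : set 'rV[R]_m :=
  interior [set l : 'rV[R]_m | Amp l /\ exists2 h, H2image [set l] h & Amp' h].

Definition convex_cone N : Prop :=
  (forall l, N l -> forall c : R, 0 < c -> N (c *: l)) /\
  (forall l l', N l -> N l' -> N (l + l')).

(* [N] spans R^{P \ K}. *)
Definition full_dimensional K N : Prop :=
  forall l, supported K l ->
    exists (r : nat) (c : 'I_r -> R) (g : 'I_r -> 'rV[R]_m),
      (forall a, N (g a)) /\ l = \sum_a c a *: g a.

Record nice_cone N : Prop := {
  nice_nef : N `<=` Nef;
  nice_convex : convex_cone N;
  nice_full : full_dimensional finset.set0 N;
  nice_face : forall K, strata K !=set0 ->
    full_dimensional K (N `&` supported K) /\
    H2image N = H2image (N `&` supported K)
}.

Definition rational_polyhedral N : Prop :=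
  exists (r : nat) (g : 'I_r -> 'rV[rat]_m),
    N = [set l : 'rV[R]_m | exists2 c : 'I_r -> R, (forall a, 0 <= c a) &
           l = \sum_a c a *: map_mx ratr (g a)].

End SncPairs.

(* Main.v *)
Require Import Defs.
From HB Require Import structures.
From mathcomp Require Import all_boot all_order all_algebra.
From mathcomp Require Import complex.
From mathcomp Require Import all_classical all_reals all_analysis.
From mathcomp Require Import ring lra.
Set Implicit Arguments.
Unset Strict Implicit.
Unset Printing Implicit Defensive.
Import Order.TTheory GRing.Theory Num.Theory.
Import numFieldNormedType.Exports.
Local Open Scope classical_set_scope.
Local Open Scope ring_scope.

(* Choose finitely many rational points a_i near a whose cone contains a in its
   interior, and for every nonempty stratum D_K a divisor in Amp(X, D^K) with
   the same image as a_i in H^2(X).  The kernel V of R^P -> H^2(X; R) is a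
   rational subspace: a Q-linear map R -> Q may be applied to the values of
   cochains, so V is stable under applying such maps to coordinates.  Hence the
   divisor supported on D^K may be perturbed, inside (a_i + V) and R^{P \ K}, to
   rational ones whose differences span V and R^{P \ K} in common.  N is the cone
   on the a_i and all these points: its image in H^2(X) is the cone on the images
   of the a_i, and so is the image of each N^K.

   The points of N are nonnegative combinations of semi-ample divisors because
   ampleness of A, applied to the coherent sheaves O(E), makes k A + E base point
   free for large k, so that rational divisors close to an ample real one have
   semi-ample multiples.  A semi-ample divisor is nef because, for sections s_a
   without common zeros, the weight log sum_a |s_a|^2 is plurisubharmonic. *)

(** * Smooth functions on C^n *)

(** Equality of the images and full-dimensionality of N^K pull in opposite directions: a generator
    may be added only if its image already lies in the cone on the images of the a_i, and yet N^K
    must span R^{P \ K}. Working modulo V reconciles them. Every generator is congruent modulo V to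
    some a_i, and each a_i to some generator g_i in R^{P \ K}, so a nonnegative combination moves
    into N^K with unchanged coefficients. For the span, an element l = \sum c_i a_i of R^{P \ K}
    differs from \sum c_i g_i by an element of V and R^{P \ K} in common, and this space is spanned
    by differences of generators congruent to one and the same a_i.

    The divisor of Amp(X, D^K) attached to a_i is only real. A Q-linear retraction R -> Q applied to
    its coordinates yields a rational point of the same affine space, possibly far from the ample
    cone; the rationality of the direction of this affine space then allows a return, through
    rational points, close to the ample divisor. *)

Section Smooth.
Variables (R : realType) (n : nat).
Implicit Types (U V : set (Cspace R n)) (f g : Cspace R n -> R).
Implicit Types (v z : Cspace R n).

(* Unlike [Ck], includes the continuity of the lower derivatives, so that it is
   monotone in the order and stable under products for each order. *)
Fixpoint CkS (r : nat) U f : Prop :=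
  (forall z, U z -> {for z, continuous f}) /\
  match r with
  | 0%N => True
  | r'.+1 => forall v, (forall z, U z -> derivable f z v) /\
                       CkS r' U (fun z => 'D_v f z)
  end.

Lemma CkS_cont r U f z : CkS r U f -> U z -> {for z, continuous f}.
Proof. by case: r => [|r] [+ _] => /(_ z). Qed.

Lemma CkSW r U f : CkS r.+1 U f -> CkS r U f.
Proof.
elim: r f => [|r IH] f [fc fd]; split=> // v.
by have [dv Dv] := fd v; split=> //; apply: IH.
Qed.

Lemma smoothP U f : smooth U f <-> forall r, CkS r U f.
Proof.
split=> [fs r|fs r].
- elim: r f fs => [|r IH] f fs; first by split=> //; exact: fs 0%N.
  split; first exact: fs 0%N.
  move=> v; split; first by have [] := fs 1%N v.
  by apply: IH => k; have [] := fs k.+1 v.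
- have := fs r; elim: r f {fs} => [|r IH] f; first by case.
  by move=> [_ fd] v; have [? ?] := fd v; split=> //; apply: IH.
Qed.

Lemma smooth_cont U f z : smooth U f -> U z -> {for z, continuous f}.
Proof. by move=> /(_ 0%N); apply. Qed.

Lemma smooth_derivable U f z v : smooth U f -> U z -> derivable f z v.
Proof. by move=> /(_ 1%N v) []; auto. Qed.

Lemma smoothD1 U f v : smooth U f -> smooth U (fun z => 'D_v f z).
Proof. by move=> fs r; have [] := fs r.+1 v. Qed.

(** Every condition in [Ck] concerns the germ of the function at a point of the set, so arbitrary
    sets [V] will do. *)
Lemma smooth_local U f :
  (forall z, U z -> exists2 V, V z & smooth V f) -> smooth U f.
Proof.
move=> H r; have {H} : forall z, U z -> exists2 V, V z & Ck r V f.
  by move=> z /H[V Vz Vs]; exists V.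
elim: r f => [|r IH] f H; first by move=> z /H[V Vz]; apply.
move=> v; split; first by move=> z /H[V Vz /(_ v)[]]; auto.
by apply: IH => z /H[V Vz /(_ v)[_]]; exists V.
Qed.

Lemma open_nbhs_eq U f g z : open U -> (forall y, U y -> f y = g y) -> U z ->
  \forall y \near z, f y = g y.
Proof.
by move=> Uo fg Uz; near=> y; apply: fg; near: y; exact: open_nbhs_nbhs.
Unshelve. all: by end_near. Qed.

Lemma eq_on_continuous U f g z : open U -> (forall y, U y -> f y = g y) ->
  U z -> {for z, continuous f} -> {for z, continuous g}.
Proof.
move=> Uo fg Uz fc; have fgz := open_nbhs_eq Uo fg Uz.
rewrite /prop_for /continuous_at -fg//.
exact: cvg_trans (near_eq_cvg fgz) fc.
Qed.

Lemma eq_on_derivable U f g v z : open U -> (forall y, U y -> f y = g y) ->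
  U z -> derivable f z v -> derivable g z v.
Proof.
by move=> Uo fg Uz; apply: near_eq_derivable; exact: open_nbhs_eq Uo fg Uz.
Qed.

Lemma eq_on_derive U f g v z : open U -> (forall y, U y -> f y = g y) ->
  U z -> 'D_v f z = 'D_v g z.
Proof.
by move=> Uo fg Uz; apply: near_eq_derive; exact: open_nbhs_eq Uo fg Uz.
Qed.

Lemma CkS_ext r U f g : open U -> (forall y, U y -> f y = g y) ->
  CkS r U f -> CkS r U g.
Proof.
move=> Uo; elim: r f g => [|r IH] f g fg [fc fd]; split=> //.
- by move=> z Uz; apply: (eq_on_continuous Uo fg Uz); exact: fc.
- by move=> z Uz; apply: (eq_on_continuous Uo fg Uz); exact: fc.
move=> v; have [dv Dv] := fd v; split.
  by move=> z Uz; apply: (eq_on_derivable Uo fg Uz); exact: dv.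
by apply: IH Dv => y Uy; exact: eq_on_derive fg Uy.
Qed.

Lemma smooth_ext U f g : open U -> (forall y, U y -> f y = g y) ->
  smooth U f -> smooth U g.
Proof.
by move=> Uo fg /smoothP fs; apply/smoothP => r; exact: CkS_ext fg (fs r).
Qed.

Lemma CkS_cst r U (c : R) : CkS r U (fun=> c).
Proof.
have cc : forall (c0 : R) z, U z -> {for z, continuous (fun _ : Cspace R n => c0)}.
  by move=> c0 z Uz; apply: cst_continuous.
elim: r c => [|r IH] c; split=> //; do ?by move=> z; exact: cc.
move=> v; split; first by move=> z _; exact: derivable_cst.
suff -> : 'D_v (fun _ : Cspace R n => c) = (fun=> 0) by exact: IH.
by apply/funext => z; exact: derive_cst.
Qed.

Lemma CkSD r U f g : open U -> CkS r U f -> CkS r U g ->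
  CkS r U (fun y => f y + g y).
Proof.
move=> Uo; elim: r f g => [|r IH] f g [fc fd] [gc gd]; split => //.
1,2: by move=> z Uz; apply: cvgD; [exact: fc|exact: gc].
move=> v; have [dv Dv] := fd v; have [dv' Dv'] := gd v; split.
  by move=> z Uz; apply: derivableD; auto.
apply: (@CkS_ext _ _ (fun z => 'D_v f z + 'D_v g z)) => //; last exact: IH.
by move=> y Uy; rewrite -deriveD//; auto.
Qed.

Lemma CkSM r U f g : open U -> CkS r U f -> CkS r U g ->
  CkS r U (fun y => f y * g y).
Proof.
move=> Uo; elim: r f g => [|r IH] f g Hf Hg.
  by split=> // z Uz; apply: cvgM; [case: Hf => + _; apply|case: Hg => + _; apply].
have := Hf; have := Hg; move=> [gc gd] [fc fd]; split.
  by move=> z Uz; apply: cvgM; [exact: fc|exact: gc].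
move=> v; have [dv Dv] := fd v; have [dv' Dv'] := gd v; split.
  by move=> z Uz; apply: derivableM; auto.
apply: (@CkS_ext _ _ (fun z => f z * 'D_v g z + g z * 'D_v f z)) => //.
  by move=> y Uy; rewrite -[LHS](@deriveM _ _ f g)//; auto.
by apply: CkSD => //; apply: IH => //; exact: CkSW.
Qed.

Lemma CkSV r U f : open U -> (forall z, U z -> f z != 0) -> CkS r U f ->
  CkS r U (fun y => (f y)^-1).
Proof.
move=> Uo f0; elim: r => [|r IH] Hf.
  by split=> // z Uz; apply: cvgV; [exact: f0|case: Hf => + _; apply].
have IHf := IH (CkSW Hf); case: Hf => fc fd; split.
  by move=> z Uz; apply: cvgV; [exact: f0|exact: fc].
move=> v; have [dv Dv] := fd v; split.
  by move=> z Uz; apply: derivableV; auto.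
apply: (@CkS_ext _ _ (fun z => (-1 * ((f z)^-1 * (f z)^-1)) * 'D_v f z)) => //.
  move=> y Uy; rewrite [RHS]deriveV; [|exact: f0|exact: dv].
  by rewrite /GRing.scale /= -exprVn expr2 mulN1r.
by apply: CkSM => //; apply: CkSM (CkS_cst _ _ _) _ => //; exact: CkSM.
Qed.

(** On the line through [z] in the direction [v] this is the chain rule in one variable. *)
Lemma is_derive_ln f z v : 0 < f z -> derivable f z v ->
  is_derive z v (fun y => ln (f y)) ((f z)^-1 * 'D_v f z).
Proof.
move=> f0 /derivable1P df.
pose h (t : R) := f (t *: v + z).
have h0 : h 0 = f z by rewrite /h scale0r add0r.
have dh : is_derive (0 : R) 1 h ('D_v f z).
  split; first exact: df.
  rewrite /derive; set g1 := fun t => t^-1 *: _; set g2 := fun t => t^-1 *: _.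
  suff -> : g1 = g2 by [].
  by apply/funext => t /=; rewrite /g1 /g2 /= /h addr0 scale0r add0r [_%:A]mulr1.
have dl : is_derive (h 0) 1 (@ln R) (h 0)^-1.
  by rewrite h0; exact: is_derive1_ln.
have := @is_derive1_comp _ _ _ _ _ _ dl dh.
rewrite h0 => -[dc Dc]; apply: DeriveDef; first exact/derivable1P.
rewrite -Dc /derive; set g1 := fun t => t^-1 *: _; set g2 := fun t => t^-1 *: _.
suff -> : g1 = g2 by [].
by apply/funext => t /=; rewrite /g1 /g2 /= /h addr0 scale0r add0r [_%:A]mulr1.
Qed.

Lemma CkS_ln r U f : open U -> (forall z, U z -> 0 < f z) -> CkS r U f ->
  CkS r U (fun y => ln (f y)).
Proof.
move=> Uo f0 Hf; have lc : forall z, U z -> {for z, continuous (fun y => ln (f y))}.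
  move=> z Uz; apply: (@continuous_comp _ _ _ f (@ln R)).
    exact: CkS_cont Hf Uz.
  exact/continuous_ln/f0.
(* The derivative [f^-1 * 'D_v f] contains no logarithm, so a case distinction on [r] replaces an
   induction. *)
case: r Hf => [|r] Hf; split=> //.
move=> v; have := Hf => -[_ /(_ v)[dv Dv]]; split.
  by move=> z Uz; have [] := is_derive_ln (f0 z Uz) (dv z Uz).
apply: (@CkS_ext _ _ (fun z => (f z)^-1 * 'D_v f z)) => //.
  by move=> z Uz; have [_ ->] := is_derive_ln (f0 z Uz) (dv z Uz).
apply: CkSM => //; apply: CkSV => //; last exact: CkSW.
by move=> z Uz; rewrite gt_eqF// f0.
Qed.

Lemma smooth_cst U (c : R) : smooth U (fun=> c).
Proof. by apply/smoothP => r; exact: CkS_cst. Qed.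

Lemma smoothD U f g : open U -> smooth U f -> smooth U g ->
  smooth U (fun y => f y + g y).
Proof. by move=> Uo /smoothP Hf /smoothP Hg; apply/smoothP => r; exact: CkSD. Qed.

Lemma smoothM U f g : open U -> smooth U f -> smooth U g ->
  smooth U (fun y => f y * g y).
Proof. by move=> Uo /smoothP Hf /smoothP Hg; apply/smoothP => r; exact: CkSM. Qed.

Lemma smoothN U f : open U -> smooth U f -> smooth U (fun y => - f y).
Proof.
move=> Uo Hf; apply: (@smooth_ext _ (fun y => -1 * f y)) => //.
  by move=> y _; rewrite mulN1r.
by apply: smoothM => //; exact: smooth_cst.
Qed.

Lemma smooth_ln U f : open U -> (forall z, U z -> 0 < f z) -> smooth U f ->
  smooth U (fun y => ln (f y)).
Proof. by move=> Uo f0 /smoothP Hf; apply/smoothP => r; exact: CkS_ln. Qed.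

Lemma smooth_sum U (I : Type) (s : seq I) (F : I -> Cspace R n -> R) : open U ->
  (forall i, smooth U (F i)) -> smooth U (fun y => \sum_(i <- s) F i y).
Proof.
move=> Uo Fs; elim: s => [|i s IH].
  apply: smooth_ext (smooth_cst U 0) => // y _; by rewrite big_nil.
apply: smooth_ext (smoothD Uo (Fs i) IH) => // y _; by rewrite big_cons.
Qed.

End Smooth.

(** * Symmetry of second directional derivatives *)

Section Schwarz.
Variables (R : realType) (n : nat).
Implicit Types (U : set (Cspace R n)) (f : Cspace R n -> R).
Implicit Types (u v w z p : Cspace R n).

Lemma is_derive_line f p u (t : R) : derivable f (t *: u + p) u ->
  is_derive t 1 (fun s : R => f (s *: u + p)) ('D_u f (t *: u + p)).
Proof.
set g1 := fun h => h^-1 *: ((fun s : R => f (s *: u + p)) (h *: 1 + t) -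
                            (fun s : R => f (s *: u + p)) t).
set g2 := fun h => h^-1 *: (f (h *: u + (t *: u + p)) - f (t *: u + p)).
have E : g1 = g2.
  by apply/funext => h; rewrite /g1 /g2 /= [_%:A]mulr1 scalerDl addrA.
move=> df; have dg : cvg (g1 @ 0^') by rewrite E.
by split=> //; rewrite /derive -/g2 -E.
Qed.

Lemma MVT_0 (g dg : R -> R) (d : R) : 0 < d ->
  (forall t, 0 <= t <= d -> is_derive t 1 g (dg t)) ->
  exists2 c, 0 <= c <= d & g d - g 0 = dg c * d.
Proof.
move=> d0 gd; have [||c] := @MVT_segment _ g dg 0 d (ltW d0).
- by move=> x; rewrite in_itv /= => /andP[x0 xd]; apply: gd; rewrite !ltW.
- apply: derivable_within_continuous => x; rewrite in_itv /= => /gd[].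
  exact: (fun h _ => h).
- by rewrite in_itv /= subr0 => cd ->; exists c.
Qed.

(** Mean value theorem twice: in the direction [v] for the increment of [f] along [d *: w], then in
    the direction [w] for ['D_v f]. *)
Lemma second_difference U f z v w (d : R) : smooth U f -> 0 < d ->
  (forall s t, 0 <= s <= d -> 0 <= t <= d -> U (s *: v + (t *: w + z))) ->
  exists s t, [/\ 0 <= s <= d, 0 <= t <= d &
   f (d *: v + (d *: w + z)) - f (d *: w + z) - (f (d *: v + z) - f z) =
   'D_w (fun y => 'D_v f y) (t *: w + (s *: v + z)) * d * d].
Proof.
move=> fs d0 Ud; have dd : 0 <= d <= d by rewrite lexx ltW.
have zd : 0 <= (0 : R) <= d by rewrite lexx ltW.
pose g s := f (s *: v + (d *: w + z)) - f (s *: v + z).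
have [|s sd Es] := @MVT_0 g
  (fun s => 'D_v f (s *: v + (d *: w + z)) - 'D_v f (s *: v + z)) d d0.
  move=> t td; apply: is_deriveB; apply: is_derive_line.
    by apply: (smooth_derivable fs); exact: Ud.
  by have := Ud t 0 td zd; rewrite scale0r add0r; exact: smooth_derivable.
have [|t td Et] := @MVT_0 (fun t => 'D_v f (t *: w + (s *: v + z)))
  (fun t => 'D_w (fun y => 'D_v f y) (t *: w + (s *: v + z))) d d0.
  move=> t td; apply: is_derive_line.
  by rewrite addrCA; apply: smooth_derivable (smoothD1 _ fs) _; exact: Ud.
exists s, t; split=> //; move: Es; rewrite /g !scale0r !add0r => Es.
move: Et; rewrite scale0r add0r addrCA => Et; rewrite Et in Es.
by rewrite -Es; ring.
Qed.

Lemma distr_half_false (a b c : R) :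
  `|a - c| < `|a - b| / 2 -> `|b - c| < `|a - b| / 2 -> False.
Proof.
move=> ac bc; have : `|a - b| < `|a - b|; last by rewrite ltxx.
rewrite {1}(_ : a - b = (a - c) - (b - c)); last by ring.
by apply: (le_lt_trans (ler_normB _ _)); rewrite [ltRHS]splitr ltrD.
Qed.

(** The second difference over a parallelogram at [z] is symmetric in [v] and [w], so the two mixed
    derivatives take a common value at two points near [z]; by continuity they cannot differ at
    [z]. *)
Lemma derive_swap U f z v w : open U -> smooth U f -> U z ->
  'D_w (fun y => 'D_v f y) z = 'D_v (fun y => 'D_w f y) z.
Proof.
move=> Uo fs Uz.
pose a y := 'D_w (fun y => 'D_v f y) y; pose b y := 'D_v (fun y => 'D_w f y) y.
have [//|ab0] := eqVneq (a z) (b z); exfalso.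
pose e := `|a z - b z|; have e0 : 0 < e by rewrite normr_gt0 subr_eq0.
have e20 : 0 < e / 2 by rewrite divr_gt0.
have ac : {for z, continuous a} := smooth_cont (smoothD1 _ (smoothD1 _ fs)) Uz.
have bc : {for z, continuous b} := smooth_cont (smoothD1 _ (smoothD1 _ fs)) Uz.
have : nbhs z [set y | [/\ U y, `|a z - a y| < e / 2 & `|b z - b y| < e / 2]].
  have nU : nbhs z U by exact: open_nbhs_nbhs.
  have na : \forall y \near z, `|a z - a y| < e / 2.
    exact: (cvgrPdist_lt _ _).1 ac _ e20.
  have nb : \forall y \near z, `|b z - b y| < e / 2.
    exact: (cvgrPdist_lt _ _).1 bc _ e20.
  by apply: filterS3 nU na nb => y; split.
move=> /nbhs_normP[r /= r0 rP].
(* With this factor the parallelogram spanned by [d *: v] and [d *: w] stays within [r] of [z]; the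
   summand 1 covers [v = w = 0]. *)
pose d := r / (`|v| + `|w| + 1).
have p0 : 0 < `|v| + `|w| + 1 by rewrite ltr_wpDl// addr_ge0.
have d0 : 0 < d by rewrite divr_gt0.
have Ud s t : 0 <= s <= d -> 0 <= t <= d ->
    [/\ U (s *: v + (t *: w + z)), `|a z - a (s *: v + (t *: w + z))| < e / 2
      & `|b z - b (s *: v + (t *: w + z))| < e / 2].
  move=> /andP[s0 sd] /andP[t0 td]; apply: rP => /=.
  rewrite addrA opprD addrCA subrr addr0 normrN.
  apply: (le_lt_trans (ler_normD _ _)).
  rewrite !normrZ (ger0_norm s0) (ger0_norm t0).
  apply: (@le_lt_trans _ _ (d * (`|v| + `|w|))).
    by rewrite mulrDr lerD// ler_wpM2r.
  by rewrite mulrAC ltr_pdivrMr// ltr_pM2l// ltrDl.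
have [|s [t [sd td Est]]] := @second_difference U f z v w d fs d0.
  by move=> s t sd td; have [] := Ud s t sd td.
have [|s' [t' [sd' td' Est']]] := @second_difference U f z w v d fs d0.
  by move=> s' t' sd' td'; rewrite addrCA; have [] := Ud t' s' td' sd'.
move: Est; rewrite [t *: w + _]addrCA => Est.
pose D := f (d *: v + (d *: w + z)) - f (d *: w + z) - (f (d *: v + z) - f z).
have Ea : D = a (s *: v + (t *: w + z)) * d * d := Est.
have Eb : D = b (t' *: v + (s' *: w + z)) * d * d.
  by rewrite -[RHS]Est' [d *: w + (d *: v + z)]addrCA /D; ring.
have dn0 : d != 0 by rewrite gt_eqF.
have ab : a (s *: v + (t *: w + z)) = b (t' *: v + (s' *: w + z)).
  apply: (mulIf dn0); apply: (mulIf dn0).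
  exact: etrans (esym Ea) Eb.
have [_ ha _] := Ud s t sd td; have [_ _ hb] := Ud t' s' td' sd'.
rewrite ab in ha; exact: distr_half_false ha hb.
Qed.

End Schwarz.

(** * Levi forms of logarithms of sums of squared moduli *)

Local Notation ReC := (@complex.Re _).
Local Notation ImC := (@complex.Im _).

(* A copy of ['D_v f z] with value in [R], locked so that neither rewriting nor
   [ring] unfolds the canonical structures of the product space. *)
HB.lock Definition dird (R : realType) (n : nat) (v : Cspace R n)
  (f : Cspace R n -> R) (z : Cspace R n) : R := 'D_v f z.

Section Dird.
Variables (R : realType) (n : nat).
Implicit Types (U : set (Cspace R n)) (f g : Cspace R n -> R).
Implicit Types (u v w z p : Cspace R n).

Lemma dirdE v f z : dird v f z = 'D_v f z.
Proof. by rewrite unlock. Qed.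

Lemma dird_funE v f : dird v f = fun z => 'D_v f z.
Proof. by apply/funext => z; rewrite unlock. Qed.

Lemma leviE f z v :
  levi f z v = dird v (dird v f) z + dird (mul_i v) (dird (mul_i v) f) z.
Proof. by rewrite !dird_funE. Qed.

Lemma smooth_dird U f v : smooth U f -> smooth U (dird v f).
Proof. by move=> fs; rewrite dird_funE; exact: smoothD1. Qed.

Lemma dird_ext U f g v z : open U -> (forall y, U y -> f y = g y) -> U z ->
  dird v f z = dird v g z.
Proof. by rewrite !dirdE; exact: eq_on_derive. Qed.

Lemma dirdC U f v w z : open U -> smooth U f -> U z ->
  dird w (dird v f) z = dird v (dird w f) z.
Proof. by rewrite !dird_funE; exact: derive_swap. Qed.

Lemma dird_cst (c : R) z u : dird u (fun=> c) z = 0.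
Proof. by rewrite dirdE; exact: derive_cst. Qed.

Section Rules.
Variables (U : set (Cspace R n)) (z u : Cspace R n).
Hypotheses (Uo : open U) (Uz : U z).

Lemma dirdD f g : smooth U f -> smooth U g ->
  dird u (fun y => f y + g y) z = dird u f z + dird u g z.
Proof.
move=> fs gs; rewrite !dirdE.
exact: (@deriveD _ _ _ f g z u (smooth_derivable fs Uz) (smooth_derivable gs Uz)).
Qed.

Lemma dirdM f g : smooth U f -> smooth U g ->
  dird u (fun y => f y * g y) z = f z * dird u g z + g z * dird u f z.
Proof.
move=> fs gs; rewrite !dirdE.
exact: (@deriveM _ _ f g z u (smooth_derivable fs Uz) (smooth_derivable gs Uz)).
Qed.

Lemma dirdZ (c : R) f : smooth U f -> dird u (fun y => c * f y) z = c * dird u f z.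
Proof.
move=> fs; rewrite dirdM//; last exact: smooth_cst.
by rewrite dird_cst mulr0 addr0.
Qed.

Lemma dirdN f : smooth U f -> dird u (fun y => - f y) z = - dird u f z.
Proof. by move=> fs; rewrite !dirdE; exact: (@deriveN _ _ _ f z u (smooth_derivable fs Uz)). Qed.

Lemma dirdX2 f : smooth U f -> dird u (fun y => f y ^+ 2) z = 2 * f z * dird u f z.
Proof.
move=> fs; rewrite (@dird_ext U _ (fun y => f y * f y))//.
by rewrite (dirdM fs fs); ring.
Qed.

Lemma dird_ln f : 0 < f z -> smooth U f ->
  dird u (fun y => ln (f y)) z = (f z)^-1 * dird u f z.
Proof.
by move=> f0 fs; rewrite !dirdE; have [_] := is_derive_ln f0 (smooth_derivable (v := u) fs Uz).
Qed.

Lemma dirdV f : f z != 0 -> smooth U f ->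
  dird u (fun y => (f y)^-1) z = - (f z)^-1 ^+ 2 * dird u f z.
Proof.
move=> f0 fs; rewrite !dirdE exprVn.
exact: (@deriveV _ _ f z u f0 (smooth_derivable fs Uz)).
Qed.

Lemma dird_sum (I : Type) (s : seq I) (F : I -> Cspace R n -> R) :
  (forall i, smooth U (F i)) ->
  dird u (fun y => \sum_(i <- s) F i y) z = \sum_(i <- s) dird u (F i) z.
Proof.
move=> Fs; elim: s => [|i s IH].
  rewrite big_nil -[RHS](dird_cst 0 z u); apply: (dird_ext _ Uo) => // y _.
  by rewrite big_nil.
rewrite big_cons -IH -dirdD//; last exact: smooth_sum.
by apply: (dird_ext _ Uo) => // y _; rewrite big_cons.
Qed.

End Rules.
End Dird.

Section Levi.
Variables (R : realType) (n : nat).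
Implicit Types (U : set (Cspace R n)) (f g : Cspace R n -> R).
Implicit Types (u v w z p : Cspace R n).

Lemma smoothX2 U f : open U -> smooth U f -> smooth U (fun y => f y ^+ 2).
Proof.
move=> Uo fs; apply: (smooth_ext Uo _ (smoothM Uo fs fs)) => y _.
by rewrite expr2.
Qed.

Lemma smoothV U f : open U -> (forall y, U y -> f y != 0) -> smooth U f ->
  smooth U (fun y => (f y)^-1).
Proof. by move=> Uo f0 /smoothP Hf; apply/smoothP => r; exact: CkSV. Qed.

Lemma levi_ln U f z v : open U -> (forall y, U y -> 0 < f y) -> smooth U f ->
  U z -> levi (fun y => ln (f y)) z v =
    (f z)^-1 * levi f z v -
    ((f z)^-1 ^+ 2) * (dird v f z ^+ 2 + dird (mul_i v) f z ^+ 2).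
Proof.
move=> Uo f0 fs Uz.
have fn0 y : U y -> f y != 0 by move=> Uy; rewrite gt_eqF// f0.
have D2 u : dird u (dird u (fun y => ln (f y))) z =
    (f z)^-1 * dird u (dird u f) z - ((f z)^-1 ^+ 2) * (dird u f z) ^+ 2.
  rewrite (dird_ext (g := fun y => (f y)^-1 * dird u f y) _ Uo)//; last first.
    by move=> y Uy; rewrite (dird_ln _ Uy)// f0.
  rewrite (dirdM _ Uz) ?(dirdV _ Uz) ?fn0//; first by ring.
    exact: smoothV.
  exact: smooth_dird.
by rewrite !leviE !D2; ring.
Qed.

Lemma levi_bigsum (I : Type) (s : seq I) U (F : I -> Cspace R n -> R) z v :
  open U -> (forall i, smooth U (F i)) -> U z ->
  levi (fun y => \sum_(i <- s) F i y) z v = \sum_(i <- s) levi (F i) z v.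
Proof.
move=> Uo Fs Uz.
have D2 u : dird u (dird u (fun y => \sum_(i <- s) F i y)) z =
    \sum_(i <- s) dird u (dird u (F i)) z.
  rewrite -(dird_sum _ Uo Uz); last by move=> i; exact: smooth_dird.
  by apply: (dird_ext _ Uo) => // y Uy; rewrite (dird_sum _ Uo Uy).
by rewrite leviE !D2 -big_split /=; apply: eq_bigr => i _; rewrite leviE.
Qed.

Lemma leviD U f g z v : open U -> smooth U f -> smooth U g -> U z ->
  levi (fun y => f y + g y) z v = levi f z v + levi g z v.
Proof.
move=> Uo fs gs Uz.
have D2 u : dird u (dird u (fun y => f y + g y)) z =
    dird u (dird u f) z + dird u (dird u g) z.
  rewrite -(dirdD _ Uz (smooth_dird u fs) (smooth_dird u gs)).
  by apply: (dird_ext _ Uo) => // y Uy; rewrite (dirdD _ Uy).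
by rewrite !leviE !D2 addrACA.
Qed.

Lemma leviZ U f (c : R) z v : open U -> smooth U f -> U z ->
  levi (fun y => c * f y) z v = c * levi f z v.
Proof.
move=> Uo fs Uz.
have D2 u : dird u (dird u (fun y => c * f y)) z = c * dird u (dird u f) z.
  rewrite -(dirdZ _ Uz); last exact: smooth_dird.
  by apply: (dird_ext _ Uo) => // y Uy; rewrite (dirdZ _ Uy).
by rewrite !leviE !D2 mulrDr.
Qed.

Lemma levi_sqr U f z v : open U -> smooth U f -> U z ->
  levi (fun y => f y ^+ 2) z v =
  2 * (dird v f z ^+ 2 + dird (mul_i v) f z ^+ 2) + 2 * f z * levi f z v.
Proof.
move=> Uo fs Uz.
have D2 u : dird u (dird u (fun y => f y ^+ 2)) z =
    2 * dird u f z ^+ 2 + 2 * f z * dird u (dird u f) z.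
  rewrite (dird_ext (g := fun y => 2 * (f y * dird u f y)) _ Uo)//; last first.
    by move=> y Uy; rewrite (dirdX2 _ Uo Uy)// mulrA.
  have fds := smooth_dird u fs.
  by rewrite (dirdZ _ Uz) ?(dirdM _ Uz)//; [ring|exact: smoothM].
by rewrite !leviE !D2; ring.
Qed.

(* Cauchy-Schwarz: the distance from (p, q) to its orthogonal projection on the
   complex line spanned by (x, y) is nonnegative. *)
Lemma complex_cauchy_schwarz (I : Type) (s : seq I) (x y p q : I -> R) :
  let S := \sum_(i <- s) (x i ^+ 2 + y i ^+ 2) in
  let A := \sum_(i <- s) (x i * p i + y i * q i) in
  let B := \sum_(i <- s) (y i * p i - x i * q i) in
  0 < S -> S^-1 * (A ^+ 2 + B ^+ 2) <= \sum_(i <- s) (p i ^+ 2 + q i ^+ 2).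
Proof.
move=> S A B S0; set T := \sum_(i <- s) _.
pose a := A / S; pose b := B / S.
have : 0 <= \sum_(i <- s) ((p i - a * x i - b * y i) ^+ 2 +
                           (q i - a * y i + b * x i) ^+ 2).
  by apply: sumr_ge0 => i _; rewrite addr_ge0 ?sqr_ge0.
rewrite (eq_bigr (fun i => (p i ^+ 2 + q i ^+ 2) +
  ((- 2 * a) * (x i * p i + y i * q i) + ((- 2 * b) * (y i * p i - x i * q i) +
  (a ^+ 2 + b ^+ 2) * (x i ^+ 2 + y i ^+ 2))))); last by move=> i _; ring.
rewrite !big_split /= -!mulr_sumr -/S -/A -/B -[_ <= T]subr_ge0.
by congr (is_true (0 <= _)); rewrite /T big_split /= /a /b; field; rewrite gt_eqF.
Qed.

Lemma holo_CR U (F : Cspace R n -> R[i]) z v : holo U F -> U z ->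
  dird (mul_i v) (fun y => ReC (F y)) z = - dird v (fun y => ImC (F y)) z /\
  dird (mul_i v) (fun y => ImC (F y)) z = dird v (fun y => ReC (F y)) z.
Proof. by move=> [_ CR] Uz; rewrite !dirdE; exact: CR. Qed.

(** Real and imaginary parts x and y are pluriharmonic: D_iv D_iv x = - D_iv D_v y = - D_v D_iv y =
    - D_v D_v x, by the Cauchy-Riemann equations and the symmetry of second derivatives. *)
Lemma holo_levi0 U (F : Cspace R n -> R[i]) z v : open U -> holo U F -> U z ->
  levi (fun y => ReC (F y)) z v = 0 /\ levi (fun y => ImC (F y)) z v = 0.
Proof.
move=> Uo Fh Uz; have [[xs ys] _] := Fh.
set x := fun y => ReC _ in xs *; set y' := fun y => ImC _ in ys *.
have Ex w : U w -> dird (mul_i v) x w = - dird v y' w.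
  by move=> Uw; have [] := holo_CR v Fh Uw.
have Ey w : U w -> dird (mul_i v) y' w = dird v x w.
  by move=> Uw; have [] := holo_CR v Fh Uw.
have ysv := smooth_dird v ys; have xsv := smooth_dird v xs.
rewrite !leviE; split.
  rewrite [X in _ + X](dird_ext _ Uo Ex Uz) (dirdN _ Uz ysv).
  by rewrite (dirdC _ _ Uo ys Uz) (dird_ext _ Uo Ey Uz) subrr.
rewrite [X in _ + X](dird_ext _ Uo Ey Uz).
by rewrite (dirdC _ _ Uo xs Uz) (dird_ext _ Uo Ex Uz) (dirdN _ Uz ysv) subrr.
Qed.

Definition normsq (w : R[i]) : R := ReC w ^+ 2 + ImC w ^+ 2.

Lemma smooth_normsq U (F : Cspace R n -> R[i]) : open U -> holo U F ->
  smooth U (fun y => normsq (F y)).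
Proof. by move=> Uo [[xs ys] _]; apply: smoothD => //; apply: smoothX2. Qed.

(** With S the sum and T the sum of the |D_v F_i|^2, the Levi form is 4 S^-1 (T - S^-1 |\sum_i
    conj(F_i) D_v F_i|^2), which is nonnegative by Cauchy-Schwarz. *)
Lemma levi_ln_normsq (I : Type) (s : seq I) U (F : I -> Cspace R n -> R[i]) z v :
  open U -> (forall i, holo U (F i)) ->
  (forall y, U y -> 0 < \sum_(i <- s) normsq (F i y)) -> U z ->
  0 <= levi (fun y => ln (\sum_(i <- s) normsq (F i y))) z v.
Proof.
move=> Uo Fh S0 Uz.
pose x i y := ReC (F i y); pose y' i y := ImC (F i y).
have xs i : smooth U (x i) by case: (Fh i) => [[]].
have ys i : smooth U (y' i) by case: (Fh i) => [[]].
have Ns i : smooth U (fun y => normsq (F i y)) by exact: smooth_normsq.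
have CRx i : dird (mul_i v) (x i) z = - dird v (y' i) z by have [] := holo_CR v (Fh i) Uz.
have CRy i : dird (mul_i v) (y' i) z = dird v (x i) z by have [] := holo_CR v (Fh i) Uz.
rewrite (levi_ln v Uo S0) //; last exact: smooth_sum.
rewrite (levi_bigsum _ v Uo Ns Uz).
have D1 u : dird u (fun y => \sum_(i <- s) normsq (F i y)) z =
    2 * \sum_(i <- s) (x i z * dird u (x i) z + y' i z * dird u (y' i) z).
  rewrite (dird_sum _ Uo Uz)// mulr_sumr; apply: eq_bigr => i _.
  rewrite /normsq (dirdD _ Uz (smoothX2 Uo (xs i)) (smoothX2 Uo (ys i))).
  by rewrite (dirdX2 _ Uo Uz (xs i)) (dirdX2 _ Uo Uz (ys i)); ring.
have L i : levi (fun y => normsq (F i y)) z v =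
    4 * (dird v (x i) z ^+ 2 + dird v (y' i) z ^+ 2).
  rewrite /normsq (leviD v Uo (smoothX2 Uo (xs i)) (smoothX2 Uo (ys i)) Uz).
  rewrite (levi_sqr v Uo (xs i) Uz) (levi_sqr v Uo (ys i) Uz).
  have [-> ->] := holo_levi0 v Uo (Fh i) Uz.
  by rewrite CRx CRy; ring.
rewrite (eq_bigr _ (fun i _ => L i)) !D1 -mulr_sumr.
have Sz := S0 z Uz.
(* This sum from Cauchy-Schwarz is half the derivative of S in the direction i v. *)
have EB : \sum_(i <- s) (y' i z * dird v (x i) z - x i z * dird v (y' i) z) =
    \sum_(i <- s) (x i z * dird (mul_i v) (x i) z + y' i z * dird (mul_i v) (y' i) z).
  by apply: eq_bigr => i _; rewrite CRx CRy; ring.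
have := @complex_cauchy_schwarz _ s (fun i => x i z) (fun i => y' i z)
  (fun i => dird v (x i) z) (fun i => dird v (y' i) z) Sz.
rewrite /= -[_ <= _]subr_ge0 -(pmulr_rge0 _ (_ : 0 < 4 * (\sum_(i <- s) normsq (F i z))^-1)).
  by rewrite EB; congr (is_true (0 <= _)); rewrite /normsq; ring.
by rewrite mulr_gt0// invr_gt0.
Qed.

End Levi.

(** * Holomorphic functions *)

Section Complex.
Variable R : realType.
Implicit Types a b : R[i].

Lemma ReD a b : ReC (a + b) = ReC a + ReC b.
Proof. by case: a b => [? ?] [? ?]. Qed.

Lemma ImD a b : ImC (a + b) = ImC a + ImC b.
Proof. by case: a b => [? ?] [? ?]. Qed.

Lemma ReM a b : ReC (a * b) = ReC a * ReC b - ImC a * ImC b.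
Proof. by case: a b => [? ?] [? ?]. Qed.

Lemma ImM a b : ImC (a * b) = ReC a * ImC b + ImC a * ReC b.
Proof. by case: a b => [? ?] [? ?]. Qed.

Lemma normsqM a b : normsq (a * b) = normsq a * normsq b.
Proof. by rewrite /normsq ReM ImM; ring. Qed.

Lemma normsq1 : normsq (1 : R[i]) = 1.
Proof. by rewrite /normsq /= expr1n expr0n addr0. Qed.

Lemma normsq_ge0 a : 0 <= normsq a.
Proof. by rewrite addr_ge0 ?sqr_ge0. Qed.

Lemma normsq_eq0 a : (normsq a == 0) = (a == 0).
Proof.
by case: a => x y; rewrite /normsq /= paddr_eq0 ?sqr_ge0// !sqrf_eq0 eq_complex.
Qed.

Lemma normsq_gt0 a : (0 < normsq a) = (a != 0).
Proof. by rewrite lt_def normsq_ge0 andbT normsq_eq0. Qed.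

Lemma normsqX a k : normsq (a ^+ k) = normsq a ^+ k.
Proof. by elim: k => [|k IH]; rewrite ?expr0 ?normsq1// !exprS normsqM IH. Qed.

Lemma ln_normsqXz a (e : int) : a != 0 ->
  ln (normsq (a ^ e)) = e%:~R * ln (normsq a).
Proof.
move=> a0; have n0 : 0 < normsq a by rewrite normsq_gt0.
have lnX k : ln (normsq (a ^+ k)) = k%:R * ln (normsq a).
  by rewrite normsqX lnXn// mulr_natl.
case: e => k; first exact: lnX.
rewrite NegzE -exprnN mulrNz mulNr -lnX -lnV ?posrE ?normsq_gt0 ?expf_neq0//.
congr ln; apply: (mulfI (lt0r_neq0 (_ : 0 < normsq (a ^+ k.+1)))).
  by rewrite normsq_gt0 expf_neq0.
rewrite -normsqM divff ?expf_neq0// normsq1 divff// normsq_eq0 expf_neq0//.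
Qed.

End Complex.

Section Holo.
Variables (R : realType) (n : nat).
Implicit Types (U V : set (Cspace R n)) (f g : Cspace R n -> R[i]).

Lemma holo_local U f :
  (forall z, U z -> exists2 V, V z & holo V f) -> holo U f.
Proof.
move=> H; split; first split.
- by apply: smooth_local => z /H[V Vz [[]]]; exists V.
- by apply: smooth_local => z /H[V Vz [[]]]; exists V.
by move=> z /H[V Vz [_]]; apply.
Qed.

Lemma holoP U f : holo U f <-> smoothC U f /\ forall z, U z -> forall v,
  dird (mul_i v) (fun y => ReC (f y)) z = - dird v (fun y => ImC (f y)) z /\
  dird (mul_i v) (fun y => ImC (f y)) z = dird v (fun y => ReC (f y)) z.
Proof.
by split=> -[? CR]; split=> // z Uz v; have := CR z Uz v; rewrite !dirdE.
Qed.

Lemma holo_ext U f g : open U -> (forall y, U y -> f y = g y) ->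
  holo U f -> holo U g.
Proof.
move=> Uo fg /holoP[[xs ys] CR].
have xe y : U y -> ReC (f y) = ReC (g y) by move=> /fg ->.
have ye y : U y -> ImC (f y) = ImC (g y) by move=> /fg ->.
apply/holoP; split.
  by split; [exact: (smooth_ext Uo xe xs)|exact: (smooth_ext Uo ye ys)].
move=> z Uz v; rewrite -!(dird_ext _ Uo xe Uz) -!(dird_ext _ Uo ye Uz).
exact: CR.
Qed.

Lemma holo_cst U (c : R[i]) : holo U (fun=> c).
Proof.
apply/holoP; split; first by split; exact: smooth_cst.
by move=> z _ v; rewrite !dird_cst oppr0.
Qed.

Lemma holoD U f g : open U -> holo U f -> holo U g ->
  holo U (fun y => f y + g y).
Proof.
move=> Uo /holoP[[xs ys] CR] /holoP[[xs' ys'] CR'].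
have Ex y : ReC (f y + g y) = ReC (f y) + ReC (g y) by exact: ReD.
have Ey y : ImC (f y + g y) = ImC (f y) + ImC (g y) by exact: ImD.
apply/holoP; rewrite /smoothC (funext Ex) (funext Ey); split.
  by split; apply: smoothD.
move=> z Uz v; rewrite !(dirdD _ Uz xs xs') !(dirdD _ Uz ys ys').
have [-> ->] := CR z Uz v; have [-> ->] := CR' z Uz v.
by split=> //; rewrite opprD.
Qed.

Lemma holoM U f g : open U -> holo U f -> holo U g ->
  holo U (fun y => f y * g y).
Proof.
move=> Uo /holoP[[xs ys] CR] /holoP[[xs' ys'] CR'].
have Ex y : ReC (f y * g y) = ReC (f y) * ReC (g y) + - (ImC (f y) * ImC (g y)).
  exact: ReM.
have Ey y : ImC (f y * g y) = ReC (f y) * ImC (g y) + ImC (f y) * ReC (g y).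
  exact: ImM.
apply/holoP; rewrite /smoothC (funext Ex) (funext Ey).
have xx := smoothM Uo xs xs'; have yy := smoothM Uo ys ys'.
have xy := smoothM Uo xs ys'; have yx := smoothM Uo ys xs'.
have yyN := smoothN Uo yy.
split; first by split; apply: smoothD.
move=> z Uz v; rewrite !(dirdD _ Uz xx yyN) !(dirdD _ Uz xy yx) !(dirdN _ Uz yy).
rewrite !(dirdM _ Uz xs xs') !(dirdM _ Uz ys ys').
rewrite !(dirdM _ Uz xs ys') !(dirdM _ Uz ys xs').
have [-> ->] := CR z Uz v; have [-> ->] := CR' z Uz v.
by split; ring.
Qed.

End Holo.

(** * Holomorphic functions on the manifold *)

Section Mholo.
Variables (R : realType) (n : nat) (X : compact_cmanifold R n).
Implicit Types (U V : set X) (f g : X -> R[i]).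

Lemma open_chart (c : chart R n X) U : is_chart c -> open U ->
  open (cod c `&` of_c c @^-1` U).
Proof.
move=> [_ co _ oc] Uo; rewrite openE => z [cz Uz].
have [_ _ cc] := oc z cz.
apply: filterI; first exact: open_nbhs_nbhs.
by apply: cc; exact: open_nbhs_nbhs.
Qed.

Lemma mholo_local U f :
  (forall x, U x -> exists2 V, V x & mholo V f) -> mholo U f.
Proof.
move=> H c cA; apply: holo_local => z [cz /H[V Vz Vf]].
by exists (cod c `&` of_c c @^-1` V) => //; exact: Vf.
Qed.

Lemma mholo_sub U V f : V `<=` U -> mholo U f -> mholo V f.
Proof. by move=> VU fh; apply: mholo_local => x Vx; exists U => //; exact: VU. Qed.

Lemma mholo_ext U f g : open U -> (forall y, U y -> f y = g y) ->
  mholo U f -> mholo U g.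
Proof.
move=> Uo fg fh c cA; apply: holo_ext (fh c cA).
  exact: open_chart (atlas_chart cA) Uo.
by move=> z [_ /fg].
Qed.

Lemma mholo_cst U (c : R[i]) : mholo U (fun=> c).
Proof. by move=> ch cA; exact: holo_cst. Qed.

Lemma mholoD U f g : open U -> mholo U f -> mholo U g ->
  mholo U (fun y => f y + g y).
Proof.
move=> Uo fh gh c cA; apply: holoD (fh c cA) (gh c cA).
exact: open_chart (atlas_chart cA) Uo.
Qed.

Lemma mholoM U f g : open U -> mholo U f -> mholo U g ->
  mholo U (fun y => f y * g y).
Proof.
move=> Uo fh gh c cA; apply: holoM (fh c cA) (gh c cA).
exact: open_chart (atlas_chart cA) Uo.
Qed.

Lemma mholoN U f : open U -> mholo U f -> mholo U (fun y => - f y).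
Proof.
move=> Uo fh; apply: (mholo_ext Uo _ (mholoM Uo (mholo_cst U (-1)) fh)) => y _.
by rewrite mulN1r.
Qed.

Lemma mholoX U f k : open U -> mholo U f -> mholo U (fun y => f y ^+ k).
Proof.
move=> Uo fh; elim: k => [|k IH]; first exact: mholo_cst.
by apply: (mholo_ext Uo _ (mholoM Uo fh IH)) => y _; rewrite exprS.
Qed.

Lemma mholo_prod U (I : Type) (s : seq I) (F : I -> X -> R[i]) : open U ->
  (forall i, mholo U (F i)) -> mholo U (fun y => \prod_(i <- s) F i y).
Proof.
move=> Uo Fh; elim: s => [|i s IH].
  by apply: (mholo_ext Uo _ (mholo_cst U 1)) => y _; rewrite big_nil.
by apply: (mholo_ext Uo _ (mholoM Uo (Fh i) IH)) => y _; rewrite big_cons.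
Qed.

Lemma mholo_normsq_continuous U f x : open U -> mholo U f -> U x ->
  {for x, continuous (fun y => normsq (f y))}.
Proof.
move=> Uo fh Ux; have [c cA dx] := atlas_cover x.
have [co _ cc oc] := atlas_chart cA; have [cx ofx tc] := cc x dx.
have Oo := open_chart (atlas_chart cA) Uo.
have Ocx : (cod c `&` of_c c @^-1` U) (to_c c x) by split => //=; rewrite ofx.
have Fc := smooth_cont (smooth_normsq Oo (fh c cA)) Ocx.
have : {for x, continuous ((fun y => normsq ((f \o of_c c) y)) \o to_c c)}.
  exact: continuous_comp tc Fc.
rewrite /prop_for /continuous_at /= ofx => h.
apply: cvg_trans h; apply: near_eq_cvg.
have : nbhs x (dom c) by exact: open_nbhs_nbhs.
by apply: filterS => y dy /=; have [_ -> _] := cc y dy.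
Qed.

Lemma open_nonvanishing U f : open U -> mholo U f ->
  open [set x | U x /\ f x != 0].
Proof.
move=> Uo fh; rewrite openE => x [Ux fx0].
have := mholo_normsq_continuous Uo fh Ux => /cvgr_gt /(_ 0).
rewrite normsq_gt0 => /(_ fx0) h.
apply: filterS2 (open_nbhs_nbhs (conj Uo Ux)) h => y Uy.
by rewrite normsq_gt0.
Qed.

End Mholo.

(** * Semi-ample divisors are nef *)

Lemma compact_finite_cover (T : topologicalType) (O : T -> set T) :
  compact [set: T] -> (forall x, open (O x)) -> (forall x, O x x) ->
  exists s : seq T, forall y, exists2 x, x \in s & O x y.
Proof.
(* A base point is needed to speak of [cover_compact]; the empty space is covered by the empty
   list. *)
move=> Tc Oo Ox; have [[x0 _]|T0] := pselect (exists x : T, True); last first.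
  by exists [::] => y; exfalso; apply: T0; exists y.
pose pT := isPointed.Build T x0.
pose T' : ptopologicalType := HB.pack (Topological.sort T) pT.
have : @cover_compact T' setT by rewrite -compact_cover.
move=> /(_ _ setT O (fun x _ => Oo x)) [|F _ Fcov]; first by move=> x _; exists x.
by exists (finmap.enum_fset F) => y; have [x xF Oxy] := Fcov y Logic.I; exists x.
Qed.

Section Bundles.
Variables (R : realType) (n : nat) (X : compact_cmanifold R n) (m : nat).
Variable D : snc_divisor X m.
Implicit Types (E : 'I_m -> int) (i j k : snc_idx D) (x : X).

Let W i : set X := dom (snc_chart i).

Lemma snc_dom_open i : open (W i).
Proof. by have [] := snc_is_chart i. Qed.

Lemma snc_tr_neq0 p i j x : W i x -> W j x -> snc_tr p i j x != 0.
Proof.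
move=> Wi Wj; have := snc_tr_cocycle p Wi Wj Wi; rewrite snc_tr_id// => e.
by apply: contra_eq_neq e => ->; rewrite mul0r eq_sym oner_neq0.
Qed.

Lemma bundle_tr_neq0 E i j x : W i x -> W j x -> bundle_tr E i j x != 0.
Proof.
move=> Wi Wj; apply/prodf_neq0 => p _; rewrite expfz_eq0 negb_and.
by rewrite snc_tr_neq0 ?orbT.
Qed.

Lemma bundle_tr_id E i x : W i x -> bundle_tr E i i x = 1.
Proof. by move=> Wi; apply: big1 => p _; rewrite snc_tr_id// exp1rz. Qed.

Lemma bundle_tr_cocycle E i j k x : W i x -> W j x -> W k x ->
  bundle_tr E i j x * bundle_tr E j k x = bundle_tr E i k x.
Proof.
move=> Wi Wj Wk; rewrite -big_split /=; apply: eq_bigr => p _.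
by rewrite -expfzMl snc_tr_cocycle.
Qed.

Lemma bundle_trD E E' i j x : W i x -> W j x ->
  bundle_tr (fun p => E p + E' p) i j x = bundle_tr E i j x * bundle_tr E' i j x.
Proof.
move=> Wi Wj; rewrite -big_split /=; apply: eq_bigr => p _.
by rewrite expfzDr// snc_tr_neq0.
Qed.

Lemma bundle_tr0 i j x : bundle_tr (fun=> 0) i j x = 1.
Proof. by apply: big1 => p _; rewrite expr0z. Qed.

Lemma bundle_trMn E r i j x : W i x -> W j x ->
  bundle_tr (fun p => r%:Z * E p) i j x = bundle_tr E i j x ^+ r.
Proof.
move=> Wi Wj; rewrite -prodrXl; apply: eq_bigr => p _.
by rewrite mulrC -exprz_exp.
Qed.

Lemma mholo_bundle_tr E i j : mholo (W i `&` W j) (bundle_tr E i j).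
Proof.
have Wo i' j' : open (W i' `&` W j') by apply: openI; exact: snc_dom_open.
apply: mholo_prod => // p; case: (E p) => r.
  by apply: mholoX => //; exact: snc_tr_holo.
(* A negative power is a positive power of the transition function in the opposite direction, which
   is holomorphic as well. *)
have h : mholo (W i `&` W j) (snc_tr p j i).
  by rewrite setIC; exact: snc_tr_holo.
apply: (mholo_ext (Wo _ _) _ (mholoX r.+1 (Wo _ _) h)) => x [Wi Wj].
rewrite NegzE -exprnN -exprVn; congr (_ ^+ _).
apply: (mulfI (snc_tr_neq0 p Wi Wj)).
by rewrite snc_tr_cocycle// snc_tr_id// divff// snc_tr_neq0.
Qed.

Lemma ln_normsq_bundle_tr E i j x : W i x -> W j x ->
  ln (normsq (bundle_tr E i j x)) =
  \sum_p (E p)%:~R * ln (normsq (snc_tr p i j x)).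
Proof.
move=> Wi Wj; rewrite /bundle_tr.
have tr0 p : snc_tr p i j x != 0 by exact: snc_tr_neq0.
(* Positivity of the partial products is carried along because [lnM] requires it. *)
have [_ ->] : 0 < normsq (\prod_p snc_tr p i j x ^ E p) /\
    ln (normsq (\prod_p snc_tr p i j x ^ E p)) =
    \sum_p ln (normsq (snc_tr p i j x ^ E p)).
  elim/big_rec2: _ => [|p y z _ [z0 zE]]; first by rewrite normsq1 ltr01 ln1.
  have t0 : 0 < normsq (snc_tr p i j x ^ E p).
    by rewrite normsq_gt0 expfz_eq0 negb_and tr0 orbT.
  by rewrite normsqM mulr_gt0// lnM ?posrE// zE.
by apply: eq_bigr => p _; rewrite ln_normsqXz.
Qed.

Lemma section_neq0 E r s i j x : is_section E r s -> W i x -> W j x ->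
  s i x != 0 -> s j x != 0.
Proof.
move=> [_ st] Wi Wj; rewrite (st i j)// mulf_eq0 negb_or => /andP[_ //].
Qed.

Lemma is_section_pow E r q s : is_section E r s ->
  is_section E (r * q) (fun i x => s i x ^+ q).
Proof.
move=> [sh st]; split.
  by move=> i; apply: mholoX => //; exact: snc_dom_open.
by move=> i j x Wi Wj; rewrite (st i j)// exprMn exprM.
Qed.

Lemma semiample_ext E E' : E =1 E' -> semiample D E -> semiample D E'.
Proof. by move=> /funext ->. Qed.

Lemma semiample0 : semiample D (fun=> 0).
Proof.
exists 1%N => // x; have [i Wi] := snc_cover D x.
exists (fun _ _ => 1); last by exists i => //; rewrite oner_neq0.
split; first by move=> j; exact: mholo_cst.
by move=> j k y _ _; rewrite bundle_tr0 expr1n mulr1.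
Qed.

(** If [s] is a section of O(r E) and [s'] one of O(r' E'), then s^r' s'^r is a section of O(r r' (E
    + E')). *)
Lemma semiampleD E E' : semiample D E -> semiample D E' ->
  semiample D (fun p => E p + E' p).
Proof.
move=> [r r0 bE] [r' r'0 bE']; exists (r * r')%N; first by rewrite muln_gt0 r0.
move=> x; have [s ss [i Wi si]] := bE x; have [s' ss' [i' Wi' si']] := bE' x.
exists (fun i x => s i x ^+ r' * s' i x ^+ r); last first.
  exists i => //; rewrite mulf_neq0// expf_neq0//.
  exact: section_neq0 ss' Wi' Wi si'.
have [sh st] := is_section_pow r' ss; have [sh' st'] := is_section_pow r ss'.
split; first by move=> j; apply: mholoM => //; exact: snc_dom_open.
move=> j k y Wj Wk; rewrite bundle_trD// exprMn (st j k)// (st' j k)//.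
by rewrite [(r' * r)%N]mulnC; ring.
Qed.

Lemma semiample_sum (I : Type) (s : seq I) (c : I -> nat) (A : I -> 'I_m -> int) :
  (forall a, semiample D (A a)) ->
  semiample D (fun p => \sum_(a <- s) (c a)%:Z * A a p).
Proof.
move=> As; elim: s => [|a s IH].
  by apply: semiample_ext semiample0 => p; rewrite big_nil.
have cA r : semiample D (fun p => r%:Z * A a p).
  elim: r => [|r IHr]; first by apply: semiample_ext semiample0 => p; rewrite mul0r.
  by apply: semiample_ext (semiampleD (As a) IHr) => p; rewrite intS mulrDl mul1r.
by apply: semiample_ext (semiampleD (cA (c a)) IH) => p; rewrite big_cons.
Qed.

Lemma hermitian_ge0 h (c : chart R n X) z v : hermitian_metric h -> atlas c ->
  cod c z -> 0 <= h c z v v.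
Proof.
move=> hh cA cz; have [->|v0] := eqVneq v 0; last exact: ltW (hm_pos hh cA cz v0).
have := hm_lin hh 1 0 0 0 cA cz; rewrite scale1r addr0 mul1r => e.
by rewrite -(addrI _ (etrans (addr0 _) e)).
Qed.

(** Local weights of a smooth metric of semi-positive curvature; the transition rule, which depends
    on the divisor, is stated separately. *)
Definition psh_weight (w : snc_idx D -> X -> R) : Prop :=
  (forall i, msmooth (W i) (w i)) /\
  forall i (c : chart R n X) z v, atlas c -> cod c z -> W i (of_c c z) ->
    0 <= levi (w i \o of_c c) z v.

(** This is the r-th root of the Fubini-Study metric pulled back by sections of O(r E); compactness
    of [X] reduces them to finitely many without common zeros. *)
Lemma semiample_weight E : semiample D E ->
  exists2 w, psh_weight w &
    forall i j x, W i x -> W j x -> w i x = w j x +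
      \sum_p (E p)%:~R * ln (normsq (snc_tr p i j x)).
Proof.
move=> [r r0 bE].
have /choice[s sP] : forall x, exists s, is_section E r s /\
    exists2 i, W i x & s i x != 0.
  by move=> x; have [s ? ?] := bE x; exists s.
pose O x := [set y | exists2 i, W i y & s x i y != 0].
have Oo x : open (O x).
  rewrite (_ : O x = \bigcup_i [set y | W i y /\ s x i y != 0]).
    apply: bigcup_open => i _; apply: open_nonvanishing; first exact: snc_dom_open.
    by have [[+ _] _] := sP x; apply.
  by apply/seteqP; split=> [y [i Wi si]|y [i _ [Wi si]]]; exists i.
have [F Fcov] := compact_finite_cover (@carrier_compact _ _ X) Oo
  (fun x => (sP x).2).
pose S i y := \sum_(x <- F) normsq (s x i y).
have S0 i y : W i y -> 0 < S i y.
  move=> Wi; have [x xF [j Wj sj]] := Fcov y.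
  rewrite /S (big_rem x)//= ltr_pwDl//; last by apply: sumr_ge0 => y0 _; exact: normsq_ge0.
  by rewrite normsq_gt0 (section_neq0 (sP x).1 Wj).
have r0R : r%:R != 0 :> R by rewrite pnatr_eq0 -lt0n.
have hol x i c : atlas c -> holo (cod c `&` of_c c @^-1` W i) (s x i \o of_c c).
  by move=> cA; have [[+ _] _] := sP x; apply.
have Uo c i : atlas c -> open (cod c `&` of_c c @^-1` W i).
  by move=> cA; apply: open_chart (atlas_chart cA) (snc_dom_open i).
have Ssm c i : atlas c -> smooth (cod c `&` of_c c @^-1` W i) (fun z => ln (S i (of_c c z))).
  move=> cA; apply: smooth_ln; first exact: Uo.
    by move=> z [_]; exact: S0.
  apply: smooth_sum => [|x]; first exact: Uo.
  by apply: smooth_normsq (hol x i c cA); exact: Uo.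
exists (fun i y => r%:R^-1 * ln (S i y)); last first.
  move=> i j y Wi Wj; have t0 := bundle_tr_neq0 E Wi Wj.
  have n0 : 0 < normsq (bundle_tr E i j y) ^+ r.
    by rewrite exprn_gt0// normsq_gt0.
  rewrite -ln_normsq_bundle_tr// (_ : S i y = normsq (bundle_tr E i j y) ^+ r * S j y).
    by rewrite lnM ?posrE ?S0// lnXn ?normsq_gt0// -mulr_natl; field.
  rewrite mulr_sumr; apply: eq_bigr => x _; have [[_ st] _] := sP x.
  by rewrite (st i j)// normsqM normsqX.
split=> [i c cA|i c z v cA cz Wi].
  by apply: smoothM; [exact: Uo|exact: smooth_cst|exact: Ssm].
have Uz : (cod c `&` of_c c @^-1` W i) z by [].
rewrite (leviZ r%:R^-1 v (Uo c i cA) (Ssm c i cA) Uz) mulr_ge0 ?invr_ge0 ?ler0n//.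
apply: (levi_ln_normsq v (Uo c i cA) (fun x => hol x i c cA)) => // y [_].
exact: S0.
Qed.

(** The weights [\sum_a c a * w a] have nonnegative Levi form, so a single metric serves every [h]
    and every [eps]. *)
Lemma sAmp_sub_Nef : sAmp D `<=` Nef D.
Proof.
move=> l [r [c [A [c0 A0 sA lE]]]].
split.
  by move=> p; rewrite lE sumr_ge0// => a _; rewrite mulr_ge0// ler0z.
move=> h hh eps eps0.
have /choice[w wP] : forall a, exists w, psh_weight w /\
    forall i j x, W i x -> W j x -> w i x = w j x +
      \sum_p (A a p)%:~R * ln (normsq (snc_tr p i j x)).
  by move=> a; have [w ? ?] := semiample_weight (sA a); exists w.
have wsm a i ch : atlas ch -> smooth (cod ch `&` of_c ch @^-1` W i) (w a i \o of_c ch).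
  by move=> cA; have [[+ _] _] := wP a; apply.
have Uo ch i : atlas ch -> open (cod ch `&` of_c ch @^-1` W i).
  by move=> cA; apply: open_chart (atlas_chart cA) (snc_dom_open i).
have cwsm a i ch : atlas ch ->
    smooth (cod ch `&` of_c ch @^-1` W i) (fun z => c a * w a i (of_c ch z)).
  by move=> cA; apply: smoothM; [exact: Uo|exact: smooth_cst|exact: wsm].
exists (fun i x => \sum_a c a * w a i x).
  split=> [i ch cA|i j x Wi Wj].
    by apply: smooth_sum; [exact: Uo|move=> a; exact: cwsm].
  rewrite (eq_bigr (fun a => c a * w a j x + c a *
      \sum_p (A a p)%:~R * ln (normsq (snc_tr p i j x)))); last first.
    by move=> a _; rewrite ((wP a).2 i j)// mulrDr.
  rewrite big_split /=; congr (_ + _).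
  under eq_bigr do rewrite mulr_sumr.
  rewrite exchange_big /=; apply: eq_bigr => p _.
  by rewrite lE mulr_suml; apply: eq_bigr => a _; rewrite mulrA.
move=> i ch z v cA cz Wi; have Uz : (cod ch `&` of_c ch @^-1` W i) z by [].
rewrite (@levi_bigsum _ _ _ _ _ (fun a z => c a * w a i (of_c ch z)) z v
  (Uo ch i cA) (fun a => cwsm a i ch cA) Uz).
apply: (@le_trans _ _ 0).
  by rewrite mulNr oppr_le0 mulr_ge0 ?(hermitian_ge0 _ hh)// ltW.
apply: sumr_ge0 => a _; rewrite (leviZ _ v (Uo ch i cA) (wsm a i ch cA) Uz).
by apply: mulr_ge0 => //; exact: ((wP a).1.2 i ch z v cA cz Wi).
Qed.

End Bundles.

(** * The sheaf O(E) *)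

Section TwistingSheaf.
Variables (R : realType) (n : nat) (X : compact_cmanifold R n) (m : nat).
Variables (D : snc_divisor X m) (E : 'I_m -> int).
Implicit Types (i j k : snc_idx D) (x : X) (U V : set X).

Let W i : set X := dom (snc_chart i).
Let raw := snc_idx D -> X -> R[i].

(* Sections of O(E) over U, as compatible families of functions on the sets
   [U `&` W i] extended by zero, so that equal sections are equal functions.
   The zmodule structure needs this to make sense for all U, open or not. *)
Definition local_section U (s : raw) : Prop :=
  [/\ open U -> forall i, mholo (U `&` W i) (s i),
      forall i j x, U x -> W i x -> W j x -> s i x = bundle_tr E i j x * s j x &
      forall i x, ~ (U x /\ W i x) -> s i x = 0].

Definition local_section_pred U : {pred raw} := fun s => `[< local_section U s >].

Fact local_section_zmod U : zmod_closed (local_section_pred U).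
Proof.
split; first by apply/asboolP; split=> *; [exact: mholo_cst|rewrite mulr0|].
move=> s t /asboolP[sh st s0] /asboolP[th tt t0]; apply/asboolP; split.
- move=> Uo i; have UWo : open (U `&` W i) by apply: openI => //; exact: snc_dom_open.
  by apply: (mholoD UWo (sh Uo i)); apply: (mholoN UWo); exact: th.
- by move=> i j x Ux Wi Wj; rewrite [LHS](_ : _ = s i x - t i x)// (st i j)// (tt i j)// -mulrBr.
- by move=> i x nU; rewrite [LHS](_ : _ = s i x - t i x)// s0// t0// subrr.
Qed.

HB.instance Definition _ U :=
  GRing.isZmodClosed.Build raw (local_section_pred U) (local_section_zmod U).

Record lsec U := LSec { lval : raw; lvalP : lval \in local_section_pred U }.

HB.instance Definition _ U := [isSub for @lval U].
HB.instance Definition _ U := [Choice of lsec U by <:].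
HB.instance Definition _ U := [SubChoice_isSubZmodule of lsec U by <:].

Lemma lsecP U (s : lsec U) : local_section U (lval s).
Proof. by apply/asboolP; exact: (lvalP s). Qed.

Lemma lsec_eq U (s t : lsec U) :
  (forall i x, U x -> W i x -> lval s i x = lval t i x) -> s = t.
Proof.
move=> st; apply: val_inj; apply/funext => i; apply/funext => x /=.
have [[Ux Wi]|nU] := pselect (U x /\ W i x); first exact: st.
have [_ _ s0] := lsecP s; have [_ _ t0] := lsecP t.
exact: etrans (s0 i x nU) (esym (t0 i x nU)).
Qed.

(** Restriction and multiplication have to be total; 0 stands in where the result would not be a
    section, for instance when multiplying by a function that is not holomorphic. *)
Definition mk_lsec U (s : raw) : lsec U :=
  if pselect (local_section U s) is left h then LSec (introT (asboolP _) h) else 0.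

Lemma mk_lsecE U s : local_section U s -> lval (mk_lsec U s) = s.
Proof. by rewrite /mk_lsec; case: pselect. Qed.

Definition clip U (s : raw) : raw :=
  fun i x => if pselect (U x /\ W i x) then s i x else 0.

Lemma clipE U s i x : U x -> W i x -> clip U s i x = s i x.
Proof. by move=> Ux Wi; rewrite /clip; case: pselect => // -[]. Qed.

Lemma clip_local_section U V (s : raw) : open U -> open V -> V `<=` U ->
  local_section U s -> local_section V (clip V s).
Proof.
move=> Uo Vo VU [sh st s0]; split.
- move=> _ i; have VWo : open (V `&` W i) by apply: openI => //; exact: snc_dom_open.
  apply: (@mholo_ext _ _ _ _ (s i)) => //; first by move=> y [? ?]; rewrite clipE.
  by apply: mholo_sub (sh Uo i); exact: setSI.
- by move=> i j x Vx Wi Wj; rewrite !clipE//; apply: st => //; exact: VU.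
- by move=> i x nV; rewrite /clip; case: pselect.
Qed.

Definition lres U V (s : lsec U) : lsec V := mk_lsec V (clip V (lval s)).

Lemma lresE U V (s : lsec U) i x : open U -> open V -> V `<=` U -> V x -> W i x ->
  lval (lres V s) i x = lval s i x.
Proof.
move=> Uo Vo VU Vx Wi; rewrite mk_lsecE ?clipE//.
exact: clip_local_section Uo Vo VU (lsecP s).
Qed.

Definition lsmul U (f : X -> R[i]) (s : lsec U) : lsec U :=
  mk_lsec U (fun i x => f x * lval s i x).

Lemma lsmulE U f (s : lsec U) i x : open U -> mholo U f ->
  lval (lsmul f s) i x = f x * lval s i x.
Proof.
move=> Uo fh; rewrite mk_lsecE//; have [sh st s0] := lsecP s; split.
- move=> _ j; have UWo : open (U `&` W j) by apply: openI => //; exact: snc_dom_open.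
  by apply: (mholoM UWo _ (sh Uo j)); apply: mholo_sub fh => y [].
- by move=> j k y Uy Wj Wk; rewrite (st j k)//; ring.
- by move=> j y nU; rewrite s0// mulr0.
Qed.

Lemma lvalD U (s t : lsec U) i x : lval (s + t) i x = lval s i x + lval t i x.
Proof. by []. Qed.

Lemma lval_sum U (I : Type) (r : seq I) (s : I -> lsec U) i x :
  lval (\sum_(a <- r) s a) i x = \sum_(a <- r) lval (s a) i x.
Proof.
elim: r => [|a r IH]; first by rewrite !big_nil.
by rewrite !big_cons lvalD IH.
Qed.

Fact lres_id U (s : lsec U) : open U -> lres U s = s.
Proof. by move=> Uo; apply: lsec_eq => i x Ux Wi; rewrite lresE. Qed.

Fact lres_comp U V T (s : lsec U) : open U -> open V -> open T ->
  T `<=` V -> V `<=` U -> lres T (lres V s) = lres T s.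
Proof.
move=> Uo Vo To TV VU; apply: lsec_eq => i x Tx Wi.
by rewrite !lresE//; [exact: subset_trans VU|exact: TV].
Qed.

Fact lres_add U V (s t : lsec U) : open U -> open V -> V `<=` U ->
  lres V (s + t) = lres V s + lres V t.
Proof.
by move=> Uo Vo VU; apply: lsec_eq => i x Vx Wi; rewrite lvalD !lresE// lvalD.
Qed.

Fact lsec_separated (F : set (set X)) (s t : lsec (\bigcup_(V in F) V)) :
  (forall V, F V -> open V) ->
  (forall V, F V -> lres V s = lres V t) -> s = t.
Proof.
move=> Fo st; apply: lsec_eq => i x [V FV Vx] Wi.
have Uo : open (\bigcup_(V in F) V) by exact: bigcup_open.
have VU : V `<=` \bigcup_(V in F) V by exact: bigcup_sup.
by rewrite -(lresE s Uo (Fo V FV) VU)// st// lresE//; exact: Fo.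
Qed.

Fact lsec_glue (F : set (set X)) (s : forall V, lsec V) :
  (forall V, F V -> open V) ->
  (forall V T, F V -> F T -> lres (V `&` T) (s V) = lres (V `&` T) (s T)) ->
  exists t : lsec (\bigcup_(V in F) V), forall V, F V -> lres V t = s V.
Proof.
move=> Fo Fs.
have Uo : open (\bigcup_(V in F) V) by exact: bigcup_open.
(* The value at [x] is read off some member of [F] containing [x]; [tE] is the independence of this
   choice. *)
pose t : raw := fun i x =>
  if pselect (exists2 V, F V & V x) is left h then lval (s (s2val (cid2 h))) i x else 0.
have tE V i x : F V -> V x -> t i x = lval (s V) i x.
  move=> FV Vx; rewrite /t; case: pselect => [h|]; last by case; exists V.
  case: (cid2 h) => T /= FT Tx.
  have [Wi|nW] := pselect (W i x); last first.
    have [_ _ sT0] := lsecP (s T); have [_ _ sV0] := lsecP (s V).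
    by rewrite sT0 ?sV0//; case.
  have o := openI (Fo V FV) (Fo T FT).
  rewrite -(lresE (s V) (Fo V FV) o (@subIsetl _ _ _) (conj Vx Tx) Wi) Fs//.
  by rewrite (lresE (s T) (Fo T FT) o (@subIsetr _ _ _) (conj Vx Tx) Wi).
have tP : local_section (\bigcup_(V in F) V) t.
  split.
  - move=> _ i; apply: mholo_local => x [[V FV Vx] Wi]; exists (V `&` W i) => //.
    have VWo : open (V `&` W i) by apply: openI; [exact: Fo|exact: snc_dom_open].
    have [sh _ _] := lsecP (s V).
    by apply: (mholo_ext VWo _ (sh (Fo V FV) i)) => y [Vy _]; rewrite (tE V).
  - move=> i j x [V FV Vx] Wi Wj; rewrite !(tE V)//.
    by have [_ st _] := lsecP (s V); exact: st.
  - move=> i x nU; rewrite /t; case: pselect => // h; case: (cid2 h) => V /= FV Vx.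
    have [_ _ s0] := lsecP (s V); apply: s0 => -[_ Wi]; apply: nU; split=> //; exists V.
exists (mk_lsec _ t) => V FV; apply: lsec_eq => i x Vx Wi.
have VU : V `<=` \bigcup_(V in F) V by exact: bigcup_sup.
by rewrite lresE ?mk_lsecE//; [exact: tE|exact: Fo].
Qed.

Definition twisting_sheaf : omodule X.
Proof.
refine (@OModule _ _ X (fun U => lsec U : zmodType) lres lsmul lres_id lres_comp
  lres_add lsec_separated lsec_glue _ _ _ _ _ _).
- move=> U f g s Uo fh gh fg; apply: lsec_eq => i x Ux Wi.
  by rewrite !lsmulE// fg.
- move=> U s Uo; apply: lsec_eq => i x Ux Wi; rewrite lsmulE ?mul1r//.
  exact: mholo_cst.
- move=> U f g s Uo fh gh; apply: lsec_eq => i x Ux Wi.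
  by rewrite !lsmulE// ?mulrA//; exact: mholoM.
- move=> U f g s Uo fh gh; apply: lsec_eq => i x Ux Wi.
  by rewrite lvalD !lsmulE// ?mulrDl//; exact: mholoD.
- move=> U f s t Uo fh; apply: lsec_eq => i x Ux Wi.
  by rewrite lvalD !lsmulE// lvalD mulrDr.
- move=> U V f s Uo Vo VU fh; have fV := mholo_sub VU fh.
  by apply: lsec_eq => i x Vx Wi; rewrite lresE// !lsmulE// lresE.
Defined.

End TwistingSheaf.

(** * Ample divisors have semi-ample multiples *)

Section Ample.
Variables (R : realType) (n : nat) (X : compact_cmanifold R n) (m : nat).
Variable D : snc_divisor X m.
Implicit Types (A E : 'I_m -> int) (i j : snc_idx D) (x : X) (U V : set X).

Let W i : set X := dom (snc_chart i).
Let Wo i : open (W i) := snc_dom_open i.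

Lemma unit_local_section E i :
  local_section E (W i) (clip (W i) (fun j x => bundle_tr E j i x)).
Proof.
split.
- move=> _ j; have WWo : open (W i `&` W j) by exact: openI.
  have h : mholo (W i `&` W j) (bundle_tr E j i).
    by rewrite setIC; exact: mholo_bundle_tr.
  by apply: (mholo_ext WWo _ h) => y [Wi Wj]; rewrite clipE.
- by move=> j k x Wi Wj Wk; rewrite !clipE// bundle_tr_cocycle.
- by move=> j x nW; rewrite /clip; case: pselect.
Qed.

(** The standard frame of O(E) over [W i]: the function 1 in the chart [i], hence the transition
    function from [i] to [j] in the chart [j]. *)
Definition unit_section E i : lsec D E (W i) :=
  mk_lsec E (W i) (clip (W i) (fun j x => bundle_tr E j i x)).

Lemma unit_sectionE E i j x : W i x -> W j x ->
  lval (unit_section E i) j x = bundle_tr E j i x.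
Proof. by move=> Wi Wj; rewrite mk_lsecE ?clipE//; exact: unit_local_section. Qed.

Lemma twisting_sheaf_coherent E : coherent (twisting_sheaf D E).
Proof.
move=> x; have [i Wix] := snc_cover D x.
(* O(E) is free of rank one over [W i]: one generator and no relation. *)
exists (W i), 1%N, 0%N, (fun _ => unit_section E i), (fun _ _ _ => 0); split=> //.
- move=> y Wiy V s Vo Vy VW; exists V; split=> //.
  have sh : mholo V (lval (s : lsec D E V) i).
    have [sh _ _] := lsecP (s : lsec D E V).
    by apply: mholo_sub (sh Vo i) => z Vz; split=> //; exact: VW.
  exists (fun _ => lval (s : lsec D E V) i) => //.
  rewrite big_ord1; apply: (@lsec_eq _ _ _ _ D E) => j z Vz Wj.
  have Wi := VW z Vz.
  rewrite [RHS]lsmulE// [LHS]lresE// [in RHS]lresE// unit_sectionE//.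
  by have [_ st _] := lsecP (s : lsec D E V); rewrite (st j i)// mulrC.
- by case.
- move=> V a Vo VW ah; rewrite big_ord1 => e0 y Vy; exists V; split=> //.
  exists (fun _ _ => 0); first by case.
  move=> k z Vz; rewrite big_ord0 ord1.
  have Wi := VW z Vz.
  have := congr1 (fun s : lsec D E V => lval s i z) e0.
  by rewrite lsmulE// lresE// unit_sectionE// bundle_tr_id// mulr1.
Qed.

(* Global generation of [O(E)] twisted by [O(A)^k] says that the untwisted
   generator of [O(E)] over a chart is a combination of global sections of
   [O(k A + E)], which therefore have no common zero. *)
Lemma ample_semiample A E : ample D A ->
  exists k0, forall k, (k0 <= k)%N -> semiample D (fun p => k%:Z * A p + E p).
Proof.
move=> /(_ _ (twisting_sheaf_coherent E))[k0 Hk]; exists k0 => k /Hk gg.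
have Do j := snc_dom_open j; exists 1%N => // x; have [i [Wix [r [t [tt gen]]]]] := gg x.
have [V [Vo Vx VW [a ah e]]] := gen (W i) (unit_section E i) (Wo i) Wix (@subset_refl _ _).
(* In the chart [i] the frame takes the value 1 at [x], so the [t b] cannot all vanish there. *)
have {}e := congr1 (fun s : lsec D E V => lval s i x) e.
rewrite /= lresE// unit_sectionE// bundle_tr_id// lval_sum in e.
have [b tb] : exists b, lval (t b i : lsec D E (W i)) i x != 0.
  apply: contrapT => nt; move/eqP: e; rewrite big1 ?oner_eq0// => b _.
  rewrite lsmulE// (lresE _ (Do i) Vo VW Vx Wix).
  have [->|tb] := eqVneq (lval (t b i : lsec D E (W i)) i x) 0; first by rewrite mulr0.
  by case: nt; exists b.
(* Each [t b j] is a section of O(E) over [W j], hence itself a family indexed by charts; its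
   component in the chart [j] represents the section of O(k A + E). *)
exists (fun j y => lval (t b j : lsec D E (W j)) j y); last by exists i.
split=> [j|j l y Wj Wl].
  have [sh _ _] := lsecP (t b j : lsec D E (W j)).
  by have := sh (Wo j) j; rewrite setIid.
have WWo := openI (Wo j) (Wo l).
have := congr1 (fun s : lsec D E (W j `&` W l) => lval s j y) (tt b j l).
rewrite /= lresE// lsmulE//; last first.
  by apply: mholoX => //; exact: mholo_bundle_tr.
rewrite lresE// => ->; have [_ st _] := lsecP (t b l : lsec D E (W l)).
by rewrite (st j l)// bundle_trD// bundle_trMn// expr1 mulrA.
Qed.

End Ample.

(** * Rational subspaces of real vector spaces *)

Section RationalFunctional.
Variable R : realType.
Implicit Types (a b x : R) (c : rat) (H : set R).

Definition Qlinear (phi : R -> rat) : Prop :=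
  (forall a b, phi (a + b) = phi a + phi b) /\
  (forall c a, phi (ratr c * a) = c * phi a).

(** A rational subspace [H] of R maximal among those avoiding [x] is a complement of the rational
    line through [x]; [phi] is the coordinate along [x]. *)
Lemma rat_functional x : x != 0 -> exists2 phi, Qlinear phi & phi x = 1.
Proof.
move=> x0.
pose sub H := [/\ H 0, forall a b, H a -> H b -> H (a + b),
  forall c a, H a -> H (ratr c * a) & ~ H x].
(* The empty set is added for the sake of the empty chain. *)
have [|H [HP Hmax]] := @Zorn_bigcup R [set H | H = set0 \/ sub H].
  move=> F FP Ftot.
  have [[H0 FH0 sH0]|nF] := pselect (exists2 H, F H & sub H); last first.
    left; apply/seteqP; split=> // a [H FH Ha].
    have [H0|sH] := FP _ FH; first by rewrite H0 in Ha.
    by apply: nF; exists H.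
  right; have Fsub H a : F H -> H a -> sub H.
    by move=> FH Ha; have [H0'|//] := FP _ FH; rewrite H0' in Ha.
  split.
  - by exists H0 => //; case: sH0.
  - move=> a b [A FA Aa] [B FB Bb].
    have [AB|BA] := Ftot _ _ FA FB.
      by exists B => //; have [_ + _ _] := Fsub _ _ FB Bb; apply=> //; exact: AB.
    by exists A => //; have [_ + _ _] := Fsub _ _ FA Aa; apply=> //; exact: BA.
  - by move=> c a [A FA Aa]; exists A => //; have [_ _ + _] := Fsub _ _ FA Aa; apply.
  - by move=> [A FA Ax]; have [_ _ _] := Fsub _ _ FA Ax.
(* The empty set is not maximal, since [[set 0]] avoids [x] too. *)
have {HP} [H0 HD HZ Hx] : sub H.
  case: HP => // H0; exfalso; apply: (Hmax [set 0]).
    by rewrite H0; split=> // /(_ 0); apply.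
  right; split=> //; first by move=> a b -> ->; rewrite addr0.
    by move=> c a ->; rewrite mulr0.
  by move=> /= xe; rewrite xe eqxx in x0.
have HN a : H a -> H (- a).
  by move=> Ha; rewrite -mulN1r -(rmorphN1 (@ratr R)); exact: HZ.
have dec a : exists c, H (a - ratr c * x).
  have [Ha|nHa] := pselect (H a); first by exists 0; rewrite rmorph0 mul0r subr0.
  (* This is H + Q a. By maximality it contains [x], with a nonzero coefficient on [a] because [H]
     does not contain [x]; the relation is then solved for [a]. *)
  pose H' := [set b | exists2 c, True & H (b - ratr c * a)].
  have HH' : H `<` H'.
    split; first by move=> b Hb; exists 0 => //; rewrite rmorph0 mul0r subr0.
    by move=> /(_ a) H'H; apply/nHa/H'H; exists 1 => //; rewrite rmorph1 mul1r subrr.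
  have [c _ Hc] : H' x.
    apply: contrapT => nH'x; apply: (Hmax H' HH'); right; split=> //.
    - by exists 0 => //; rewrite rmorph0 mul0r subr0.
    - move=> b b' [c _ Hc] [c' _ Hc']; exists (c + c') => //.
      by rewrite rmorphD mulrDl opprD addrACA; exact: HD.
    - move=> c b [c' _ Hc']; exists (c * c') => //.
      have -> : ratr c * b - ratr (c * c') * a = ratr c * (b - ratr c' * a).
        by rewrite rmorphM; ring.
      exact: HZ.
  have c0 : c != 0 by apply: contra_not_neq Hx => c0; rewrite c0 rmorph0 mul0r subr0 in Hc.
  exists c^-1.
  have -> : a - ratr c^-1 * x = - (ratr c^-1 * (x - ratr c * a)).
    by rewrite mulrBr mulrA -rmorphM mulVf// rmorph1 mul1r opprB.
  by apply/HN/HZ.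
have /choice[phi phiP] := dec.
have phi_uniq a c : H (a - ratr c * x) -> phi a = c.
  move=> Hc; apply: contrapT => /eqP nc.
  have d0 : phi a - c != 0 by rewrite subr_eq0.
  apply: Hx; rewrite -[x]mul1r -(rmorph1 (@ratr R)) -(mulVf d0) rmorphM -mulrA.
  apply: HZ; rewrite rmorphB mulrBl.
  have -> : ratr (phi a) * x - ratr c * x = (a - ratr c * x) - (a - ratr (phi a) * x).
    by ring.
  by apply: HD => //; exact/HN/phiP.
exists phi; last by apply: phi_uniq; rewrite rmorph1 mul1r subrr.
split=> [a b|c a]; apply: phi_uniq.
  by rewrite rmorphD mulrDl opprD addrACA; exact: HD.
have -> : ratr c * a - ratr (c * phi a) * x = ratr c * (a - ratr (phi a) * x).
  by rewrite rmorphM; ring.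
exact: HZ.
Qed.

Lemma Qlinear_sum phi (I : Type) (s : seq I) (c : I -> rat) (a : I -> R) :
  Qlinear phi ->
  phi (\sum_(i <- s) ratr (c i) * a i) = \sum_(i <- s) c i * phi (a i).
Proof.
move=> [pD pZ]; elim: s => [|i s IH]; last by rewrite !big_cons pD pZ IH.
by rewrite !big_nil -(mul0r 0) -[X in X * 0](rmorph0 (@ratr R)) pZ mul0r.
Qed.

End RationalFunctional.

Section RationalSubspace.
Variables (R : realType) (m : nat).
Implicit Types (V : set 'rV[R]_m).

Local Notation "A ^R" := (map_mx (@ratr R) A) (at level 2, format "A ^R").

Definition lin_subspace V : Prop :=
  V 0 /\ forall (c : R) l l', V l -> V l' -> V (c *: l + l').

Lemma subspace_sum V (I : Type) (s : seq I) (c : I -> R) (g : I -> 'rV[R]_m) :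
  lin_subspace V -> (forall i, V (g i)) -> V (\sum_(i <- s) c i *: g i).
Proof.
by move=> [V0 VD] Vg; elim: s => [|i s IH]; rewrite ?big_nil// big_cons; exact: VD.
Qed.

(** Let the rational matrix [M] with rows in [V] have maximal rank. If [l] in [V] escaped its real
    row space, some coordinate of [l] times the cokernel of [M] would be nonzero. A rational
    functional equal to 1 on that coordinate commutes with the rational cokernel, so it sends [l] to
    a rational row in [V] outside the row space of [M], against maximality. *)
Lemma rational_subspace V : lin_subspace V ->
  (forall phi l, Qlinear phi -> V l -> V (map_mx phi l)^R) ->
  exists r (M : 'M[rat]_(r, m)), forall l, V l <-> (l <= M^R)%MS.
Proof.
move=> Vs Vphi.
pose P k := `[< exists r (M : 'M[rat]_(r, m)),
  (forall i, V (row i M)^R) /\ \rank M = k >].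
have exP : exists k, P k.
  by exists 0%N; apply/asboolP; exists 0%N, 0; split=> [[]//|]; rewrite mxrank0.
have bP k : P k -> (k <= m)%N.
  by move=> /asboolP[r [M [_ <-]]]; exact: rank_leq_col.
have [k /asboolP[r [M [MV Mk]]] kmax] := ex_maxnP exP bP.
exists r, M => l; split=> [Vl|/submxP[y ->]]; last first.
  rewrite mulmx_sum_row; apply: subspace_sum => // i.
  by rewrite -map_row.
apply: contrapT => /negP; rewrite submxE -map_cokermx => nl.
have [j xj] : exists j, (l *m (cokermx M)^R) 0 j != 0.
  apply: contrapT => nj; case/negP: nl; apply/eqP/rowP => j; rewrite [RHS]mxE.
  by apply: contrapT => /eqP xj; apply: nj; exists j.
have [phi pl p1] := rat_functional xj.
pose q := map_mx phi l.
have qM : (q <= M)%MS.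
  have : (\rank (col_mx M q) <= k)%N.
    apply: kmax; apply/asboolP; exists (r + 1)%N, (col_mx M q); split=> // i.
    case: (split_ordP i) => i' ->; first by rewrite rowKu.
    by rewrite rowKd row_id; exact: Vphi.
  rewrite -Mk -addsmxE => h; apply: submx_trans (addsmxSr M q) _.
  by rewrite -(geq_leqif (mxrank_leqif_sup (addsmxSl M q))).
move: qM; rewrite submxE => /eqP/rowP/(_ j); rewrite [RHS]mxE => q0.
suff : (1 : rat) = 0 by move/eqP; rewrite oner_eq0.
rewrite -p1 -q0 !mxE.
under eq_bigr do rewrite mxE mulrC.
rewrite Qlinear_sum//; apply: eq_bigr => i _.
by rewrite !mxE mulrC.
Qed.

Lemma rat_dense (x e : R) : 0 < e -> exists q : rat, `|ratr q - x| < e.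
Proof.
move=> e0; have [|q] := @rat_in_itvoo R (x - e) (x + e).
  by rewrite ltrD2l (lt_trans _ e0)// oppr_lt0.
rewrite in_itv /= => /andP[q1 q2]; exists q; rewrite ltr_norml; apply/andP; split.
  by rewrite ltrBrDl.
by rewrite ltrBlDl.
Qed.

End RationalSubspace.

(** * Rational approximation of solutions of linear systems *)

Section RationalApproximation.
Variable R : realType.

Local Notation "A ^R" := (map_mx (@ratr R) A) (at level 2, format "A ^R").

Lemma mulmx_small (p q : nat) (M : 'M[R]_(p, q)) (e : R) : 0 < e ->
  exists2 d : R, 0 < d & forall w : 'rV[R]_p, (forall j, `|w 0 j| < d) ->
    forall i, `|(w *m M) 0 i| < e.
Proof.
move=> e0; pose S := \sum_i \sum_j `|M j i|.
have S0 : 0 <= S by apply: sumr_ge0 => i _; apply: sumr_ge0.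
have B0 : 0 < 1 + S by rewrite ltr_pwDl.
have d0 : 0 < e / (1 + S) by rewrite divr_gt0.
exists (e / (1 + S)) => // w wd i; rewrite mxE.
apply: le_lt_trans (ler_norm_sum _ _ _) _.
apply: (@le_lt_trans _ _ (\sum_j (e / (1 + S)) * `|M j i|)).
  by apply: ler_sum => j _; rewrite normrM ler_wpM2r// ltW.
rewrite -mulr_sumr mulrAC ltr_pdivrMr// ltr_pM2l//.
have Si : \sum_j `|M j i| <= S.
  rewrite /S [leRHS](bigD1 i)//= lerDl.
  by apply: sumr_ge0 => k _; apply: sumr_ge0.
by apply: le_lt_trans Si _; rewrite ltrDr.
Qed.

(** A rational system solvable over R is solvable over Q. The difference of [c] and a rational
    solution is a real combination of the rows of a rational kernel matrix, and its coefficients can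
    be rounded. *)
Lemma rational_solution_dense (p q : nat) (A : 'M[rat]_(p, q)) (b : 'rV[rat]_q)
    (c : 'rV[R]_p) (e : R) : c *m A^R = b^R -> 0 < e ->
  exists2 c' : 'rV[rat]_p, c' *m A = b & forall i, `|ratr (c' 0 i) - c 0 i| < e.
Proof.
move=> cA e0.
have /submxP[c0 bE] : (b <= A)%MS by rewrite -(map_submx (@ratr R)) -cA submxMl.
have /submxP[y yE] : (c - c0^R <= (kermx A)^R)%MS.
  by rewrite map_kermx; apply/sub_kermxP; rewrite mulmxBl cA bE map_mxM subrr.
have KA := mulmx_ker A; move: (kermx A) KA yE => K KA yE.
have [d d0 dP] := mulmx_small K^R e0.
have /choice[y' y'P] := fun j => rat_dense (y 0 j) d0.
exists (c0 + \row_j y' j *m K); first by rewrite mulmxDl -mulmxA KA mulmx0 addr0 bE.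
move=> i; have -> : ratr ((c0 + \row_j y' j *m K) 0 i) - c 0 i =
    (((\row_j y' j)^R - y) *m K^R) 0 i.
  rewrite mulmxBl -yE -map_mxM; move: (_ *m K) => Z.
  by rewrite !mxE rmorphD; ring.
by apply: dP => j; rewrite !mxE.
Qed.

End RationalApproximation.

(** * The kernel of the map to the cohomology of X *)

Section CohomologyKernel.
Variables (R : realType) (n : nat) (X : compact_cmanifold R n) (m : nat).
Variable D : snc_divisor X m.
Implicit Types (l : 'rV[R]_m) (N : set 'rV[R]_m) (K : {set 'I_m}).

Local Notation "A ^R" := (map_mx (@ratr R) A) (at level 2, format "A ^R").

Lemma coboundary_lin k (c : R) (u u' : cochain X k) f :
  coboundary (fun g => c * u g + u' g) f = c * coboundary u f + coboundary u' f.
Proof.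
by rewrite /coboundary mulr_sumr -big_split; apply: eq_bigr => a _ /=; ring.
Qed.

(** The coefficients of the coboundary are signs, hence rational, so [phi] passes through it. *)
Lemma coboundary_Qlinear phi k (u : cochain X k) f : Qlinear phi ->
  coboundary (fun g => ratr (phi (u g)) : R) f = ratr (phi (coboundary u f)).
Proof.
move=> pl; rewrite /coboundary.
under [in RHS]eq_bigr do rewrite -(rmorph_sign (@ratr R)).
rewrite Qlinear_sum// raddf_sum; apply: eq_bigr => a _.
by rewrite -(rmorph_sign (@ratr R)) -rmorphM.
Qed.

Lemma is_cochain_map (psi : R -> R) k (u : cochain X k) :
  is_cochain u -> is_cochain (fun g => psi (u g)).
Proof. by move=> uc f g fs gs fg; rewrite (uc f g). Qed.

Lemma is_cochain_lin (c : R) k (u u' : cochain X k) :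
  is_cochain u -> is_cochain u' -> is_cochain (fun g => c * u g + u' g).
Proof. by move=> uc uc' f g fs gs fg; rewrite (uc f g)// (uc' f g). Qed.

Lemma coboundary0 k f : coboundary ((fun=> 0) : cochain X k) f = 0.
Proof. by apply: big1 => a _; rewrite mulr0. Qed.

Lemma class_of_divisor0 : class_of_divisor D (fun=> 0) 0.
Proof.
split; last by move=> p f _ _; rewrite mxE.
by split=> //; split=> // f _; rewrite coboundary0.
Qed.

Lemma class_of_divisor_lin (c : R) u u' l l' :
  class_of_divisor D u l -> class_of_divisor D u' l' ->
  class_of_divisor D (fun f => c * u f + u' f) (c *: l + l').
Proof.
move=> [[[uc ub] ur] ul] [[[uc' ub'] ur'] ul'].
split; last by move=> p f fs fd; rewrite !mxE (ul p f)// (ul' p f).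
split; last by move=> f fs fD; rewrite ur ?ur'// mulr0 addr0.
split; first exact: is_cochain_lin.
by move=> f fs; rewrite coboundary_lin ub ?ub'// mulr0 addr0.
Qed.

Lemma Qlinear0 phi : Qlinear phi -> phi (0 : R) = 0.
Proof. by move=> [_ pZ]; have := pZ 0 0; rewrite mulr0 mul0r. Qed.

Lemma class_of_divisor_Qlinear phi u l : Qlinear phi ->
  class_of_divisor D u l ->
  class_of_divisor D (fun f => ratr (phi (u f))) (map_mx phi l)^R.
Proof.
move=> pl [[[uc ub] ur] ul]; have p0 := Qlinear0 pl.
split; last by move=> p f fs fd; rewrite !mxE (ul p f).
split; last by move=> f fs fD; rewrite ur// p0 rmorph0.
split; first exact: (is_cochain_map (fun x => ratr (phi x))).
by move=> f fs; rewrite coboundary_Qlinear// ub// p0 rmorph0.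
Qed.

Lemma cohomologous_lin (c : R) k (u u' v v' : cochain X k.+1) :
  cohomologous u u' -> cohomologous v v' ->
  cohomologous (fun f => c * u f + v f) (fun f => c * u' f + v' f).
Proof.
move=> [b bc ub] [b' bc' ub']; exists (fun f => c * b f + b' f).
  exact: is_cochain_lin.
by move=> f fs; rewrite coboundary_lin ub// ub'//; ring.
Qed.

Lemma cohomologous_refl k (u : cochain X k.+1) : cohomologous u u.
Proof. by exists (fun=> 0) => // f _; rewrite coboundary0 addr0. Qed.

Lemma cohomologous_ext k (u u' v v' : cochain X k.+1) :
  u =1 v -> u' =1 v' -> cohomologous u u' -> cohomologous v v'.
Proof. by move=> /funext -> /funext ->. Qed.

(** Subtracting the relation from the reflexive one for u + v exchanges its two sides. *)
Lemma cohomologous_sym k (u v : cochain X k.+1) :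
  cohomologous u v -> cohomologous v u.
Proof.
move=> uv; have := cohomologous_lin (-1) uv (cohomologous_refl (fun f => u f + v f)).
by apply: cohomologous_ext => f; ring.
Qed.

Lemma cohomologous_trans k (u v w : cochain X k.+1) :
  cohomologous u v -> cohomologous v w -> cohomologous u w.
Proof.
move=> uv vw; have := cohomologous_lin 1 uv vw.
move=> /(cohomologous_lin 1)/(_ (cohomologous_refl (fun f => - v f))).
by apply: cohomologous_ext => f; ring.
Qed.

Lemma H2class_eq (u v : cochain X 2) : cohomologous u v -> H2class u = H2class v.
Proof.
move=> uv; apply/seteqP; split=> w [wc wu]; split=> //.
  exact: cohomologous_trans uv.
exact: cohomologous_trans (cohomologous_sym uv).
Qed.

Lemma H2class_inj (u v : cochain X 2) : is_cocycle u -> H2class u = H2class v ->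
  cohomologous u v.
Proof.
move=> uc uv; have : H2class u u by split=> //; exact: cohomologous_refl.
by rewrite uv => -[].
Qed.

(* The kernel of R^P -> H^2(X; R).  Neither the existence nor the uniqueness of
   the relative class of a divisor is used: [l] is in the kernel as soon as one
   relative cocycle of class [l] is a coboundary on X. *)
Definition H2kernel : set 'rV[R]_m :=
  [set l | exists2 u, class_of_divisor D u l & cohomologous u (fun=> 0)].

Lemma H2kernel_subspace : lin_subspace H2kernel.
Proof.
split.
  exists ((fun=> 0) : cochain X 2); last exact: cohomologous_refl.
  exact: class_of_divisor0.
move=> c l l' [u ul u0] [u' ul' u0']; exists (fun f => c * u f + u' f).
  exact: class_of_divisor_lin.
by apply: cohomologous_ext (cohomologous_lin c u0 u0') => // f; rewrite mulr0 addr0.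
Qed.

Lemma H2kernel_Qlinear phi l : Qlinear phi -> H2kernel l ->
  H2kernel (map_mx phi l)^R.
Proof.
move=> pl [u ul [b bc ub]]; exists (fun f => ratr (phi (u f))).
  exact: class_of_divisor_Qlinear.
exists (fun f => ratr (phi (b f))).
  exact: (is_cochain_map (fun x => ratr (phi x))).
by move=> f fs; rewrite add0r coboundary_Qlinear// ub// add0r.
Qed.

(** If [u] has class l and [v] has class l - l' and is a coboundary on X, then u - v has class l'
    and the same image as [u]. *)
Lemma H2image_sub N N' : (forall l, N l -> exists2 l', N' l' & H2kernel (l - l')) ->
  H2image D N `<=` H2image D N'.
Proof.
move=> NN' h [u [l [Nl ul ->]]]; have [l' N'l' [v vl v0]] := NN' l Nl.
exists (fun f => -1 * v f + u f), l'; split=> //.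
  by have := class_of_divisor_lin (-1) vl ul; rewrite scaleN1r opprB subrK.
apply: H2class_eq; apply: cohomologous_sym.
apply: cohomologous_ext (cohomologous_lin (-1) v0 (cohomologous_refl u)) => // f.
by rewrite mulr0 add0r.
Qed.

Lemma H2image_kernel l N h : H2image D [set l] h -> H2image D N h ->
  exists2 l', N l' & H2kernel (l - l').
Proof.
move=> [u [_ [-> ul ->]]] [u' [l' [Nl' ul' e]]]; exists l' => //.
exists (fun f => -1 * u' f + u f).
  by have := class_of_divisor_lin (-1) ul' ul; rewrite scaleN1r addrC.
have uu' : cohomologous u u' by apply: H2class_inj e; case: ul => [[]].
have := cohomologous_lin (-1) (cohomologous_refl u') uu'.
by apply: cohomologous_ext => // f; rewrite mulN1r addNr.
Qed.

End CohomologyKernel.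

(** * Openness of the ample cone *)

Lemma uniform_bound (I : finType) (P : I -> nat -> Prop) :
  (forall i, exists k0, forall k, (k0 <= k)%N -> P i k) ->
  exists k0, forall k, (k0 <= k)%N -> forall i, P i k.
Proof.
move=> /choice[f fP]; exists (\max_i f i) => k kf i; apply: fP.
exact: leq_trans (leq_bigmax i) kf.
Qed.

Section AmpleOpen.
Variables (R : realType) (n : nat) (X : compact_cmanifold R n) (m : nat).
Variable D : snc_divisor X m.
Implicit Types (A E : 'I_m -> int) (l : 'rV[R]_m) (q : 'rV[rat]_m).
Implicit Types (K : {set 'I_m}) (p : 'I_m).

Local Notation "A ^R" := (map_mx (@ratr R) A) (at level 2, format "A ^R").

Definition real_divisor E : 'rV[R]_m := \row_p (E p)%:~R.

(** Strict positivity lets the coefficients be moved to rational ones in [semiample_interior_rat].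
    The divisors [A a] may have negative coefficients; effectivity comes from the coordinates of the
    sum, in [AmpK_open]. *)
Definition semiample_interior : set 'rV[R]_m :=
  [set l | exists (r : nat) (c : 'I_r -> R) (A : 'I_r -> 'I_m -> int),
    [/\ forall a, 0 < c a, forall a, semiample D (A a) &
        l = \sum_a c a *: real_divisor (A a)]].

Lemma semiample_interior0 : semiample_interior 0.
Proof.
exists 0%N, (fun=> 1), (fun _ _ => 0); split=> //; first by case.
by rewrite big_ord0.
Qed.

Lemma semiample_interiorD l l' : semiample_interior l -> semiample_interior l' ->
  semiample_interior (l + l').
Proof.
move=> [r [c [A [c0 sA ->]]]] [r' [c' [A' [c0' sA' ->]]]].
exists (r + r')%N, (fun a => match fintype.split a with inl b => c b | inr b => c' b end),
  (fun a => match fintype.split a with inl b => A b | inr b => A' b end).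
split; [by move=> a; case: fintype.split|by move=> a; case: fintype.split|].
rewrite big_split_ord /=; congr (_ + _); apply: eq_bigr => a _.
  by rewrite (unsplitK (inl a)).
by rewrite (unsplitK (inr a)).
Qed.

Lemma semiample_interiorZ (c : R) A : 0 < c -> semiample D A ->
  semiample_interior (c *: real_divisor A).
Proof.
move=> c0 sA; exists 1%N, (fun=> c), (fun=> A); split=> //.
by rewrite big_ord1.
Qed.

Lemma semiample_interior_sum (I : Type) (s : seq I) (g : I -> 'rV[R]_m) :
  (forall i, semiample_interior (g i)) -> semiample_interior (\sum_(i <- s) g i).
Proof.
move=> gs; elim: s => [|i s IH]; first by rewrite big_nil; exact: semiample_interior0.
by rewrite big_cons; exact: semiample_interiorD.
Qed.

(** For one large k all of k A_a, k A_0 + D_p and k A_0 - D_p are semi-ample. The last two with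
    weights [al p] and [d] produce (al_p - d) D_p = (q_p - l_p) D_p at the price of k (al_p + d)
    A_0, which is deducted from the coefficient of A_0 in [l]. *)
Lemma ampleR_open l : ampleR D l -> exists2 d : R, 0 < d &
  forall q : 'rV[R]_m, (forall p, `|q 0 p - l 0 p| < d) -> semiample_interior q.
Proof.
move=> [r [c [A [c0 aA lE]]]].
have [k1 k1P] := uniform_bound (fun a : 'I_r.+1 => ample_semiample (fun=> 0) (aA a)).
have [k2 k2P] := uniform_bound
  (fun p : 'I_m => ample_semiample (fun p' => (p' == p)%:Z) (aA ord0)).
have [k3 k3P] := uniform_bound
  (fun p : 'I_m => ample_semiample (fun p' => - (p' == p)%:Z) (aA ord0)).
pose k := (maxn k1 (maxn k2 k3)).+1.
have {}k1P := k1P k (leqW (leq_maxl _ _)).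
have {}k2P := k2P k (leqW (leq_trans (leq_maxl _ _) (leq_maxr _ _))).
have {}k3P := k3P k (leqW (leq_trans (leq_maxr _ _) (leq_maxr _ _))).
have k0 : 0 < k%:R :> R by rewrite ltr0n.
have kn0 : k%:R != 0 :> R by rewrite gt_eqF.
have t0 : 0 < 3 * m%:R * k%:R + 1 :> R by rewrite ltr_wpDl// !mulr_ge0.
(* Each al_p + d is at most 3 d, so the total deduction is at most 3 m k d, which is less than
   [c ord0]. *)
pose d := c ord0 / (3 * m%:R * k%:R + 1).
have d0 : 0 < d by rewrite divr_gt0.
exists d => // q ql.
pose al p := d + (q 0 p - l 0 p).
have al0 p : 0 < al p.
  by have := ql p; rewrite ltr_norml => /andP[h _]; rewrite /al -ltrBlDl sub0r.
have ald p : al p <= 2 * d.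
  have := ql p; rewrite ltr_norml => /andP[_ h].
  by rewrite /al mulr2n mulrDl mul1r lerD2l ltW.
pose s := \sum_p (al p + d).
have sk : k%:R * s < c ord0.
  apply: (@le_lt_trans _ _ (3 * m%:R * k%:R * d)).
    rewrite [leRHS](_ : _ = k%:R * \sum_(p < m) (2 * d + d)); last first.
      by rewrite sumr_const card_ord -mulr_natl; ring.
    rewrite ler_wpM2l// ler_sum// => p _; by rewrite lerD2r.
  rewrite /d mulrA ltr_pdivrMr// mulrC ltr_pM2l//.
  by rewrite ltrDl.
pose ca a := (if a == ord0 then c ord0 - k%:R * s else c a) / k%:R.
have ca0 a : 0 < ca a.
  by rewrite divr_gt0//; case: eqP => // _; rewrite subr_gt0.
have -> : q = \sum_a ca a *: real_divisor (fun p => k%:Z * A a p + 0) +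
  \sum_p (al p *: real_divisor (fun p' => k%:Z * A ord0 p' + (p' == p)%:Z) +
          d *: real_divisor (fun p' => k%:Z * A ord0 p' + - (p' == p)%:Z)).
  apply/rowP => p; rewrite !mxE !summxE.
  rewrite (eq_bigr (fun a => c a * (A a p)%:~R -
      (if a == ord0 then k%:R * s * (A ord0 p)%:~R else 0))); last first.
    move=> a _; rewrite !mxE addr0 intrM /ca.
    by case: eqP => [->|_]; field.
  rewrite [X in _ + X](eq_bigr (fun p' => (al p' + d) * (k%:R * (A ord0 p)%:~R) +
      (if p' == p then al p' - d else 0))); last first.
    move=> p' _; rewrite !mxE !intrD intrM intrN eq_sym.
    by case: eqP => [->|_] /=; ring.
  rewrite sumrB -lE -big_mkcond /= big_pred1_eq.
  rewrite big_split /= -mulr_suml -/s -big_mkcond /= big_pred1_eq /al.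
  by ring.
apply: semiample_interiorD.
  by apply: semiample_interior_sum => a; exact: semiample_interiorZ.
apply: semiample_interior_sum => p; apply: semiample_interiorD.
  exact: semiample_interiorZ.
exact: semiample_interiorZ.
Qed.

Definition has_semiample_multiple q : Prop :=
  exists2 M : nat, (0 < M)%N &
    exists2 E, semiample D E & forall p, (E p)%:~R = M%:R * q 0 p.

(** The coefficients solve a linear system with rational data, so a nearby rational solution exists;
    clearing its denominators gives an integral combination of semi-ample divisors. *)
Lemma semiample_interior_rat q : semiample_interior q^R -> has_semiample_multiple q.
Proof.
move=> [r [c [A [c0 sA qE]]]].
(* Rational coefficients within [e] of the [c a] remain positive. *)
pose e := \big[Num.min/1]_a c a.
have e0 : 0 < e by rewrite /e; elim/big_ind: _ => // x y x0 y0; rewrite lt_min x0.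
have ec a : e <= c a by exact: bigmin_le_cond.
pose B : 'M[rat]_(r, m) := \matrix_(a, p) (A a p)%:~R.
have [c' c'B c'c] : exists2 c' : 'rV[rat]_r, c' *m B = q &
    forall a, `|ratr (c' 0 a) - (\row_a c a) 0 a| < e.
  apply: rational_solution_dense e0; rewrite qE; apply/rowP => p.
  by rewrite !mxE summxE; apply: eq_bigr => a _; rewrite !mxE ratr_int.
have c'0 a : 0 < c' 0 a.
  rewrite -(ltr0q R); have := c'c a; rewrite mxE ltr_norml => /andP[h _].
  by have := lt_le_trans h (lexx _); rewrite ltrBrDl; apply: le_lt_trans; rewrite subr_ge0.
pose x a := c' 0 a.
(* [M] is a common denominator of the coefficients [x a], and [na a] is the integer [M * x a]. *)
pose M := (\prod_a `|denq (x a)|)%N.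
pose na a := (`|numq (x a)| * \prod_(b | b != a) `|denq (x b)|)%N.
have naE a : (na a)%:R = M%:R * x a :> rat.
  rewrite /na /M [in RHS](bigD1 a)//= !natrM.
  suff -> : `|numq (x a)|%N%:R = `|denq (x a)|%N%:R * x a by ring.
  rewrite !natr_absz (gtr0_norm (denq_gt0 _)) gtr0_norm; last first.
    by rewrite numq_gt0; exact: c'0.
  by rewrite mulrC numqE.
exists M; first by rewrite prodn_gt0// => a; rewrite absz_gt0 denq_neq0.
exists (fun p => \sum_a (na a)%:Z * A a p); first exact: semiample_sum.
move=> p; rewrite -c'B mxE mulr_sumr rmorph_sum; apply: eq_bigr => a _.
by rewrite mxE mulrA -/(x a) -naE rmorphM.
Qed.

Definition effective_semiample q : Prop :=
  (forall p, 0 <= q 0 p) /\ has_semiample_multiple q.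

Lemma AmpK_open K l : AmpK D K l -> exists2 d : R, 0 < d &
  forall q, supported K q^R -> (forall p, `|ratr (q 0 p) - l 0 p| < d) ->
    effective_semiample q.
Proof.
move=> [ls l0 /ampleR_open[d d0 dP]].
(* Closeness below the coordinates of [l] outside [K] keeps those of [q] nonnegative; on [K] they
   vanish by the support condition. *)
exists (\big[Num.min/d]_(p | p \notin K) l 0 p).
  by elim/big_ind: _ => // x y x0 y0; rewrite lt_min x0.
move=> q qs ql; split.
  move=> p; have [pK|pK] := boolP (p \in K).
    by have := qs p pK; rewrite mxE => /eqP; rewrite fmorph_eq0 => /eqP ->.
  have /ltW := lt_le_trans (ql p) (@bigmin_le_cond _ _ _ d p _ (fun p => l 0 p) pK).
  rewrite ler_norml => /andP[+ _]; rewrite lerBrDl subrr => h.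
  by rewrite -(ler0q R).
apply/semiample_interior_rat/dP => p; rewrite mxE.
by apply: lt_le_trans (ql p) _; exact: bigmin_le_id.
Qed.

Lemma effective_semiample_cone (r : nat) (g : 'I_r -> 'rV[rat]_m) (c : 'I_r -> R) :
  (forall a, effective_semiample (g a)) -> (forall a, 0 <= c a) ->
  sAmp D (\sum_a c a *: (g a)^R).
Proof.
move=> gs c0.
have /choice[ME MEP] a : exists ME : nat * ('I_m -> int), (0 < ME.1)%N /\
    (semiample D ME.2 /\ forall p, (ME.2 p)%:~R = ME.1%:R * g a 0 p).
  by have [_ [M M0 [E sE EM]]] := gs a; exists (M, E).
exists r, (fun a => c a / (ME a).1%:R), (fun a => (ME a).2); split.
- by move=> a; rewrite divr_ge0.
- move=> a p; rewrite -(ler0z rat) (MEP a).2.2 mulr_ge0//; exact: (gs a).1.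
- by move=> a; have [_ []] := MEP a.
move=> p; rewrite summxE; apply: eq_bigr => a _; rewrite !mxE.
have [M0 [_ ME2]] := MEP a.
rewrite /= -(ratr_int R) ME2 rmorphM rmorph_nat; field.
by rewrite pnatr_eq0 -lt0n.
Qed.

End AmpleOpen.

(** * Rational polyhedral cones *)

Section LinearSpan.
Variables (R : realType) (m : nat).
Implicit Types (N : set 'rV[R]_m) (l : 'rV[R]_m).

(** [full_dimensional K N] unfolds to the inclusion of [supported K] in [lin_span N]. *)
Definition lin_span N : set 'rV[R]_m :=
  [set l | exists (r : nat) (c : 'I_r -> R) (g : 'I_r -> 'rV[R]_m),
    (forall a, N (g a)) /\ l = \sum_a c a *: g a].

Lemma lin_span_subspace N : lin_subspace (lin_span N).
Proof.
split; first by exists 0%N, (fun=> 0), (fun=> 0); split; [case|rewrite big_ord0].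
move=> k l l' [r [c [g [Ng ->]]]] [r' [c' [g' [Ng' ->]]]].
exists (r + r')%N,
  (fun a => match fintype.split a with inl b => k * c b | inr b => c' b end),
  (fun a => match fintype.split a with inl b => g b | inr b => g' b end).
split; first by move=> a; case: fintype.split.
rewrite big_split_ord /= scaler_sumr; congr (_ + _); apply: eq_bigr => a _.
  by rewrite (unsplitK (inl a)) scalerA.
by rewrite (unsplitK (inr a)).
Qed.

Lemma lin_span_mem N l : N l -> lin_span N l.
Proof.
by move=> Nl; exists 1%N, (fun=> 1), (fun=> l); rewrite big_ord1 scale1r.
Qed.

Lemma lin_span_mono N N' : N `<=` N' -> lin_span N `<=` lin_span N'.
Proof.
by move=> NN' l [r [c [g [Ng ->]]]]; exists r, c, g; split=> // a; exact: NN'.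
Qed.

Lemma subspaceB (V : set 'rV[R]_m) l l' : lin_subspace V -> V l -> V l' -> V (l - l').
Proof. by move=> [_ VD] Vl Vl'; have := VD (-1) _ _ Vl' Vl; rewrite scaleN1r addrC. Qed.

Lemma supported_subspace (K : {set 'I_m}) : lin_subspace (@supported R m K).
Proof.
split; first by move=> p _; rewrite mxE.
by move=> c l l' lK l'K p pK; rewrite !mxE lK// l'K// mulr0 addr0.
Qed.

End LinearSpan.

Section RationalCone.
Variables (R : realType) (m : nat).
Implicit Types (s : seq 'rV[rat]_m) (l : 'rV[R]_m).

Local Notation "A ^R" := (map_mx (@ratr R) A) (at level 2, format "A ^R").

Definition rational_cone s : set 'rV[R]_m :=
  [set l | exists2 c : 'I_(size s) -> R, (forall a, 0 <= c a) &
    l = \sum_a c a *: (s`_a)^R].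

Lemma rational_cone_mem s g : g \in s -> rational_cone s g^R.
Proof.
move=> gs; have gi : (index g s < size s)%N by rewrite index_mem.
exists (fun a => (a == Ordinal gi)%:R); first by move=> a; exact: ler0n.
rewrite (bigD1 (Ordinal gi))//= eqxx scale1r nth_index// big1 ?addr0//.
by move=> a /negbTE ->; rewrite scale0r.
Qed.

Lemma rational_cone0 s : rational_cone s 0.
Proof.
by exists (fun=> 0) => //; rewrite big1// => a _; rewrite scale0r.
Qed.

Lemma rational_coneD s l l' : rational_cone s l -> rational_cone s l' ->
  rational_cone s (l + l').
Proof.
move=> [c c0 ->] [c' c0' ->]; exists (fun a => c a + c' a).
  by move=> a; rewrite addr_ge0.
by rewrite -big_split; apply: eq_bigr => a _; rewrite scalerDl.
Qed.

Lemma rational_coneZ s (k : R) l : 0 <= k -> rational_cone s l ->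
  rational_cone s (k *: l).
Proof.
move=> k0 [c c0 ->]; exists (fun a => k * c a); first by move=> a; rewrite mulr_ge0.
by rewrite scaler_sumr; apply: eq_bigr => a _; rewrite scalerA.
Qed.

Lemma rational_cone_sum s (I : Type) (r : seq I) (c : I -> R) (g : I -> 'rV[R]_m) :
  (forall i, 0 <= c i) -> (forall i, rational_cone s (g i)) ->
  rational_cone s (\sum_(i <- r) c i *: g i).
Proof.
move=> c0 gs; elim: r => [|i r IH]; first by rewrite big_nil; exact: rational_cone0.
by rewrite big_cons; apply: rational_coneD => //; exact: rational_coneZ.
Qed.

End RationalCone.

(** * Cross-polytopes with rational centre and vertices *)

Section CrossPolytope.
Variables (R : realType) (m : nat) (q : 'rV[rat]_m) (e : rat).
Hypothesis e0 : 0 < e.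

Local Notation "A ^R" := (map_mx (@ratr R) A) (at level 2, format "A ^R").

Definition cross_vertex (i : option ('I_m * bool)) : 'rV[rat]_m :=
  if i is Some (p, b) then q + (if b then e else - e) *: delta_mx 0 p else q.

Lemma sum_cross (V : zmodType) (F : option ('I_m * bool) -> V) :
  \sum_i F i = F None + \sum_p (F (Some (p, true)) + F (Some (p, false))).
Proof.
rewrite (bigD1 None)//=; congr (_ + _).
rewrite (reindex_omap Some id)/=; last by case.
rewrite (eq_bigl xpredT); last by move=> i; rewrite eqxx.
rewrite (eq_bigr (fun i : 'I_m * bool => F (Some (i.1, i.2)))); last by case.
rewrite -(pair_bigA _ (fun p b => F (Some (p, b)))) /=; apply: eq_bigr => p _.
by rewrite (bigD1 true)//= (bigD1 false)//= big1 ?addr0//; case.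
Qed.

Lemma cross_vertexE p b : (cross_vertex (Some (p, b)))^R =
  q^R + (if b then ratr e else - ratr e) *: delta_mx 0 p.
Proof.
apply/rowP => j; rewrite !mxE rmorphD rmorphM rmorph_nat.
by case: b; rewrite ?rmorphN.
Qed.

(** The positive and negative parts of each x_p - q_p, divided by e, are the weights of the two
    vertices on that axis; the centre takes the remaining weight, nonnegative by the bound on the
    l^1 norm. *)
Lemma cross_polytope_cone (x : 'rV[R]_m) :
  \sum_p `|x 0 p - ratr (q 0 p)| <= ratr e ->
  exists2 c, (forall i, 0 <= c i) & x = \sum_i c i *: (cross_vertex i)^R.
Proof.
move=> xe; have e0R : 0 < ratr e :> R by rewrite ltr0q.
pose d p := x 0 p - ratr (q 0 p).
exists (fun i => match i with
  | Some (p, b) => (`|d p| + (if b then d p else - d p)) / 2 / ratr e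
  | None => 1 - (\sum_p `|d p|) / ratr e end).
  case=> [[p b]|].
    have d1 := ler_norm (d p); have := ler_norm (- d p); rewrite normrN => d2.
    apply: divr_ge0; last exact: ltW.
    by apply: divr_ge0 => //; case: b; lra.
  by rewrite subr_ge0 ler_pdivrMr// mul1r.
rewrite sum_cross; apply/rowP => j; rewrite !mxE summxE.
rewrite [X in _ + X](eq_bigr (fun p => `|d p| / ratr e * ratr (q 0 j) +
    (if p == j then d j else 0))); last first.
  move=> p _; rewrite !cross_vertexE !mxE /= eq_sym.
  by case: eqP => [->|_] /=; field; rewrite gt_eqF.
rewrite big_split /= -big_mkcond /= big_pred1_eq -!mulr_suml /d.
by ring.
Qed.

Lemma cross_polytope_span (l : 'rV[R]_m) :
  exists c, l = \sum_i c i *: (cross_vertex i)^R.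
Proof.
have e0R : ratr e != 0 :> R by rewrite gt_eqF// ltr0q.
(* Each basis vector is (vertex - centre) / e. *)
exists (fun i => match i with
  | Some (p, b) => if b then l 0 p / ratr e else 0
  | None => - \sum_p l 0 p / ratr e end).
rewrite sum_cross; apply/rowP => j; rewrite !mxE summxE.
rewrite [X in _ + X](eq_bigr (fun p => l 0 p / ratr e * ratr (q 0 j) +
    (if p == j then l 0 j else 0))); last first.
  move=> p _; rewrite !cross_vertexE !mxE /= eq_sym.
  by case: eqP => [->|_] /=; field.
rewrite big_split /= -big_mkcond /= big_pred1_eq -!mulr_suml.
by ring.
Qed.

End CrossPolytope.

(** * Construction of the nice cone *)

Section NiceCone.
Variables (R : realType) (n : nat) (X : compact_cmanifold R n) (m : nat).
Variable D : snc_divisor X m.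
Implicit Types (l : 'rV[R]_m) (N : set 'rV[R]_m) (K : {set 'I_m}).

Local Notation "A ^R" := (map_mx (@ratr R) A) (at level 2, format "A ^R").

Definition kernel_on K : set 'rV[R]_m := H2kernel D `&` @supported R m K.

Lemma kernel_on_subspace K : lin_subspace (kernel_on K).
Proof.
have [V0 VD] := H2kernel_subspace D; have [S0 SD] := supported_subspace R K.
by split=> [//|c l l' [? ?] [? ?]]; split; [exact: VD|exact: SD].
Qed.

Lemma kernel_on_rational K :
  exists r (M : 'M[rat]_(r, m)), forall l, kernel_on K l <-> (l <= M^R)%MS.
Proof.
apply: rational_subspace; first exact: kernel_on_subspace.
move=> phi l pl [Vl lK]; split; first exact: H2kernel_Qlinear.
by move=> p pK; rewrite !mxE lK// Qlinear0// rmorph0.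
Qed.

(** [g] is the companion of [q] in R^{P \ K}. All of [s] is congruent to [q] modulo the kernel, so
    these points enlarge the span of the face but not the image in cohomology. *)
Lemma face_generators K (q : 'rV[rat]_m) l : AmpK D K l -> H2kernel D (q^R - l) ->
  exists (g : 'rV[rat]_m) (s : seq 'rV[rat]_m),
    [/\ g \in s,
        forall h, h \in s -> [/\ effective_semiample D h, supported K h^R &
                                 H2kernel D (q^R - h^R)] &
        forall v, kernel_on K v -> lin_span [set h^R | h in [set` s]] v].
Proof.
move=> lA Vql; have [d d0 dP] := AmpK_open lA.
have lK : supported K l by case: lA.
have [r [M MP]] := kernel_on_rational K.
have MV (y : 'rV[rat]_r) : kernel_on K (y *m M)^R.
  by apply/MP; rewrite map_mxM submxMl.
(* A Q-linear retraction of R onto Q: it fixes the rationals because [phi 1 = 1]. *)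
have [phi pl p1] := rat_functional (oner_neq0 R).
have pratr c : phi (ratr c) = c by rewrite -[ratr c]mulr1 pl.2 p1 mulr1.
pose l1 := map_mx phi l.
have l1K : supported K l1^R by move=> p pK; rewrite !mxE lK// Qlinear0// rmorph0.
have Vql1 : H2kernel D (q^R - l1^R).
  have := H2kernel_Qlinear pl Vql.
  rewrite (_ : map_mx phi _ = q - l1) ?map_mxB//; apply/rowP => p.
  rewrite !mxE pl.1 pratr; congr (_ + _).
  by have := pl.2 (-1) (l 0 p); rewrite rmorphN1 !mulN1r.
have Sl1 : lin_subspace (@supported R m K) := supported_subspace R K.
have VS := H2kernel_subspace D.
have : kernel_on K (l - l1^R).
  split; last exact: (subspaceB Sl1).
  have -> : l - l1^R = (q^R - l1^R) - (q^R - l) by apply/rowP => p; rewrite !mxE; ring.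
  exact: (subspaceB VS).
move=> /MP/submxP[y yE].
have [rho rho0 rhoP] := mulmx_small M^R d0.
(* One half of [rho] is for rounding [y], the other for the shift by [eta]. *)
have rho20 : 0 < rho / 2 by rewrite divr_gt0.
have /choice[z zP] := fun j => rat_dense (y 0 j) rho20.
have [eta] := @rat_in_itvoo R 0 (rho / 2) rho20.
rewrite in_itv /= => /andP[eta0 eta1].
have eta0' : ratr eta != 0 :> R by rewrite gt_eqF.
(* Adding [y *m M^R] to [l1^R] gives back [l]. Here [y] is rounded to rational coefficients, and one
   of them may be shifted by [eta], so that differences recover multiples of the rows of [M]. *)
pose w (o : option 'I_r) : 'rV[rat]_r :=
  \row_j z j + (if o is Some b then eta *: delta_mx 0 b else 0).
pose g o : 'rV[rat]_m := l1 + w o *m M.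
exists (g None), (g None :: [seq g (Some b) | b <- enum 'I_r]); split.
- by rewrite inE eqxx.
- have gP o : [/\ effective_semiample D (g o), supported K (g o)^R &
                  H2kernel D (q^R - (g o)^R)].
    have gE : (g o)^R = l1^R + (w o *m M)^R.
      by rewrite -map_mxD.
    have [Vw Kw] := MV (w o).
    have gK : supported K (g o)^R by move=> p pK; rewrite gE mxE l1K// Kw// addr0.
    split=> //; last by rewrite gE opprD addrA; exact: (subspaceB VS).
    apply: dP => // p.
    have -> : ratr (g o 0 p) - l 0 p = (((w o)^R - y) *m M^R) 0 p.
      have gp : ratr (g o 0 p) = (g o)^R 0 p by rewrite [RHS]mxE.
      rewrite gp {gp}.
      rewrite mulmxBl -yE -map_mxM gE; move: (_ *m M) => Z.
      by rewrite !mxE; ring.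
    apply: rhoP => j; have zj := zP j.
    rewrite /w !mxE rmorphD addrAC (splitr rho).
    apply: le_lt_trans (ler_normD _ _) _; apply: ltr_leD => //.
    case: o {gE Vw Kw gK} => [b|]; last by rewrite mxE rmorph0 normr0 ltW.
    rewrite !mxE rmorphM rmorph_nat normrM (gtr0_norm eta0) normr_nat.
    apply: le_trans (ltW eta1); apply: ler_piMr; first exact: ltW.
    by rewrite lern1 leq_b1.
  by move=> h; rewrite inE => /orP[/eqP ->|/mapP[b _ ->]]; exact: gP.
move=> v /MP/submxP[t ->]; rewrite mulmx_sum_row.
apply: subspace_sum; first exact: lin_span_subspace.
move=> b; set S := [set _ | _ in _].
have Sg o : lin_span S (g o)^R.
  apply: lin_span_mem; exists (g o) => //=; rewrite inE.
  case: o => [c|]; last by rewrite eqxx.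
  by apply/orP; right; apply/mapP; exists c; rewrite ?mem_enum.
have -> : row b M^R = (ratr eta)^-1 *: ((g (Some b))^R - (g None)^R) + 0.
  rewrite addr0 -map_mxB /g opprD addrACA subrr add0r -mulmxBl /w opprD addrACA subrr.
  rewrite add0r subr0 -scalemxAl -rowE map_mxZ scalerA mulVf// scale1r.
  by rewrite map_row.
have [S0 SD] := lin_span_subspace S.
by apply: SD => //; exact: (subspaceB (lin_span_subspace S)).
Qed.

End NiceCone.

Lemma nbhs_rowP (R : realType) (m : nat) (a : 'rV[R]_m) (A : set 'rV[R]_m) :
  nbhs a A <-> exists2 e : R, 0 < e &
    forall x : 'rV[R]_m, (forall p, `|x 0 p - a 0 p| < e) -> A x.
Proof.
split=> [/nbhs_ballP[e /= e0 eA]|[e e0 eA]].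
  by exists e => // x xa; apply: eA; split=> // i j; rewrite ord1 /ball /= distrC.
apply/nbhs_ballP; exists e => //= x xa; apply: eA => p.
by have := xa.2 ord0 p; rewrite /ball /= distrC.
Qed.

Theorem lemma3p27 (R : realType) (n : nat) (X : compact_cmanifold R n) (m : nat)
    (D : snc_divisor X m) (hK : kahler D) (a : 'rV[R]_m) (ha : Amp_nice D a) :
  exists N : set 'rV[R]_m,
    [/\ nice_cone D N, interior N a, rational_polyhedral N & N `<=` sAmp D].
Proof.
have [e e0 eG] := (nbhs_rowP _ _).1 ha.
have m0 : 0 < 2 * m%:R + 2 :> R by rewrite ltr_wpDl// mulr_ge0.
have [eta] := @rat_in_itvoo R 0 (e / (2 * m%:R + 2)) (divr_gt0 e0 m0).
rewrite in_itv /= => /andP[eta0 eta1].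
have eta0q : 0 < eta by rewrite -(ltr0q R).
(* The points q +- eps e_p lie within eta + eps = (2 m + 2) eta < e of [a], while a point within eta
   of [a] has l^1 distance at most 2 m eta < eps from [q]. *)
pose eps : rat := (2 * m%:R + 1) * eta.
have eps0 : 0 < eps by rewrite mulr_gt0// ltr_wpDl// mulr_ge0.
have epsE : ratr eps = (2 * m%:R + 1) * ratr eta :> R.
  by rewrite rmorphM rmorphD rmorphM rmorph1 !rmorph_nat.
have /choice[zq zqP] := fun p => rat_dense (a 0 p) eta0.
pose q : 'rV[rat]_m := \row_p zq p.
pose I := option ('I_m * bool) : finType.
pose pt : I -> 'rV[rat]_m := cross_vertex q eps.
pose rl := map_mx (@ratr R) : 'rV[rat]_m -> 'rV[R]_m.
have ptG i : Amp D (rl (pt i)) /\ exists2 h, H2image D [set rl (pt i)] h & Amp' D h.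
  apply: eG => p; have E : ratr eta + ratr eps < e.
    have -> : ratr eta + ratr eps = ratr eta * (2 * m%:R + 2) :> R by rewrite epsE; ring.
    by rewrite -ltr_pdivlMr.
  have zp := zqP p; case: i => [[p' b]|].
    rewrite /rl /pt cross_vertexE !mxE addrAC.
    apply: le_lt_trans (ler_normD _ _) _; apply: lt_trans E; apply: ltr_leD => //.
    rewrite normrM (_ : `|if b then _ else _| = ratr eps); last first.
      by case: b; rewrite ?normrN gtr0_norm// ltr0q.
    by rewrite normr_nat ler_piMr ?lern1 ?leq_b1// ltW// ltr0q.
  by rewrite /rl /pt !mxE; apply: lt_trans zp _; apply: lt_trans E; rewrite ltrDl ltr0q.
pose ok K := K = finset.set0 \/ strata D K !=set0.
have VS := H2kernel_subspace D.
have V0 : H2kernel D 0 by exact: VS.1.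
have lift i K : ok K -> exists2 l, AmpK D K l & H2kernel D (rl (pt i) - l).
  have [Ai [h ih Ah]] := ptG i => -[->|/Ah Kh]; last exact: H2image_kernel ih Kh.
  by exists (rl (pt i)) => //; rewrite subrr.
have /choice[gs gsP] (iK : I * {set 'I_m}) : exists gs : 'rV[rat]_m * seq 'rV[rat]_m,
    ok iK.2 -> [/\ gs.1 \in gs.2,
      forall h, h \in gs.2 -> [/\ effective_semiample D h, supported iK.2 (rl h) &
                                  H2kernel D (rl (pt iK.1) - rl h)] &
      forall v, kernel_on D iK.2 v -> lin_span [set rl h | h in [set` gs.2]] v].
  have [okK|nK] := pselect (ok iK.2); last by exists (0, [::]).
  have [l lA Vl] := lift iK.1 iK.2 okK.
  by have [g [s gsP]] := face_generators lA Vl; exists (g, s).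
pose gens := [seq pt i | i <- enum I] ++
  flatten [seq (gs iK).2 | iK <- enum {: I * {set 'I_m}} & `[< ok iK.2 >]].
have pt_gens i : pt i \in gens by rewrite mem_cat map_f// mem_enum.
have gs_gens i K h : ok K -> h \in (gs (i, K)).2 -> h \in gens.
  move=> okK hgs; rewrite mem_cat; apply/orP; right; apply/flatten_mapP.
  by exists (i, K) => //; rewrite mem_filter mem_enum andbT; apply/asboolP.
have gensP g : g \in gens ->
    effective_semiample D g /\ exists i, H2kernel D (rl (pt i) - rl g).
  rewrite mem_cat => /orP[/mapP[i _ ->]|/flatten_mapP[[i K]]].
    split; last by exists i; rewrite subrr.
    have [Ai _] := ptG i; have [d d0 dP] := AmpK_open Ai.
    by apply: dP => [|p]; [case: Ai|rewrite mxE subrr normr0].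
  rewrite mem_filter => /andP[/asboolP okK _] gK.
  by have [_ /(_ g gK)[? _ ?] _] := gsP (i, K) okK; split=> //; exists i.
pose N := @rational_cone R m gens.
have Npt i : N (rl (pt i)) by exact: rational_cone_mem.
have NsAmp : N `<=` sAmp D.
  move=> l [c c0 ->]; apply: effective_semiample_cone => // b.
  by have [] := gensP _ (mem_nth 0 (ltn_ord b)).
have ptspan (S : set 'rV[R]_m) : lin_subspace S -> (forall i, S (rl (pt i))) -> forall l, S l.
  by move=> SS Spt l; have [c ->] := cross_polytope_span q eps0 l; exact: subspace_sum.
exists N; split=> //; last 1 first.
- exists (size gens), (fun b => gens`_b); apply/seteqP; split=> l [c c0 ->].
    by exists c.
  by exists c.
- split.
  + by move=> l /NsAmp; exact: sAmp_sub_Nef.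
  + split=> [l Nl c c0|l l']; last exact: rational_coneD.
    by apply: rational_coneZ => //; exact: ltW.
  + move=> l _; apply: (ptspan (lin_span N)); first exact: lin_span_subspace.
    by move=> i; exact: lin_span_mem.
  move=> K sK; have okK : ok K by right.
  pose g i := (gs (i, K)).1.
  have gP i := gsP (i, K) okK.
  have NKgs i h : h \in (gs (i, K)).2 -> (N `&` supported K) (rl h).
    move=> hgs; split; first by apply: rational_cone_mem; exact: gs_gens hgs.
    by have [_ /(_ h hgs)[]] := gP i.
  have NKg i : (N `&` supported K) (rl (g i)) by apply: (NKgs i); have [] := gP i.
  have Vg i : H2kernel D (rl (pt i) - rl (g i)).
    by have [gi /(_ _ gi)[]] := gP i.
  split.
  + move=> l lK; set S := N `&` _.
    have SS := lin_span_subspace S.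
    have [c lE] := cross_polytope_span q eps0 l.
    pose l' := \sum_i c i *: rl (g i).
    have Sl' : lin_span S l' by apply: subspace_sum SS _ => i; apply: lin_span_mem; exact: NKg.
    have l'K : supported K l'.
      by apply: subspace_sum; [exact: supported_subspace|move=> i; have [] := NKg i].
    have Vl : kernel_on D K (l - l').
      split; last exact: (subspaceB (supported_subspace R K)).
      rewrite lE /l' -sumrB; under eq_bigr do rewrite -scalerBr.
      exact: (subspace_sum _ _ VS).
    (* The face generators attached to the single point [pt None] already span the kernel in R^{P \
       K}. *)
    have [_ _ /(_ _ Vl) Sl] := gP None.
    have -> : l = 1 *: (l - l') + l' by rewrite scale1r subrK.
    apply: SS.2 => //; apply: lin_span_mono Sl => _ [h hgs <-].
    exact: NKgs hgs.
  apply/seteqP; split; last first.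
    by apply: H2image_sub => l [Nl _]; exists l => //; rewrite subrr.
  (* Each generator is replaced by the companion of the point [pt i] congruent to it, with the same
     coefficient. *)
  apply: H2image_sub => l [c c0 ->].
  have /choice[i iP] (b : 'I_(size gens)) : exists i, H2kernel D (rl (pt i) - rl (gens`_b)).
    by have [] := gensP _ (mem_nth 0 (ltn_ord b)).
  exists (\sum_b c b *: rl (g (i b))).
    split; first by apply: rational_cone_sum => // b; have [] := NKg (i b).
    by apply: subspace_sum; [exact: supported_subspace|move=> b; have [] := NKg (i b)].
  rewrite -sumrB; under eq_bigr do rewrite -scalerBr.
  apply: (subspace_sum _ _ VS) => b.
  have -> : rl gens`_b - rl (g (i b)) =
      (rl (pt (i b)) - rl (g (i b))) - (rl (pt (i b)) - rl gens`_b).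
    by apply/rowP => p; rewrite !mxE; ring.
  exact: (subspaceB VS).
apply/nbhs_rowP; exists (ratr eta) => // x xa.
have [|c c0 ->] := @cross_polytope_cone _ _ q eps eps0 x.
  apply: (@le_trans _ _ (\sum_(p < m) 2 * ratr eta)).
    apply: ler_sum => p _; rewrite mxE.
    have -> : x 0 p - ratr (zq p) = (x 0 p - a 0 p) - (ratr (zq p) - a 0 p) by ring.
    by apply: le_trans (ler_normB _ _) _; rewrite mulr2n mulrDl mul1r lerD// ltW.
  rewrite sumr_const card_ord -mulr_natl epsE -subr_ge0.
  by rewrite [leRHS](_ : _ = ratr eta) ?ltW//; ring.
exact: rational_cone_sum.
Qed.
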